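(* Let $n\ge3$ and $1\le m\le n$. The unitary highest weight representation of $\mathfrak g=\mathfrak{so}(2,n)$ belonging to the minimal non-zero discrete Wallach point $\lambda=\frac{n-2}2$ decomposes under restriction to the subalgebra $\mathfrak h=\mathfrak{so}(2,m)\oplus\mathfrak{so}(n-m)$ as $$d\pi_\lambda^{\mathfrak{so}(2,n)}=\bigoplus_{k=0}^\infty d\pi_{\lambda+k}^{\mathfrak{so}(2,m)}\boxtimes\mathcal H^k(\mathbb R^{n-m}).$$
   Context: For $j\ge1$ let $V_j=\mathbb R^{1,j-1}=\mathbb R\times\mathbb R^{j-1}$ be the Euclidean Jordan algebra with product $(x_1,x')(y_1,y')=(x_1y_1+x'\cdot y',x_1y'+y_1x')$ and unit $e=(1,0)$; put $\operatorname{tr}(x)=2x_1$ and $(x|y)=\operatorname{tr}(xy)$. For $j\ge3$ it is simple of rank $r=2$, dimension $j$ and root multiplicity $d=j-2$, with Jordan trace $\operatorname{tr}$ and trace form $(\cdot|\cdot)$. With $L(x)$ the multiplication operators, put $P(x,y)=L(x)L(y)+L(y)L(x)-L(xy)$ and $x\Box y=L(xy)+[L(x),L(y)]$. The structure algebra is $\mathfrak l_j=\{D+L(a):a\in V_j,\ D\in\mathfrak{so}(j-1)\}$, with $\mathfrak{so}(j-1)$ acting on $x_2,\dots,x_j$; $T^\#$ is the adjoint of $T$ for $(\cdot|\cdot)$. The conformal Lie algebra of $V_j$, isomorphic to $\mathfrak{so}(2,j)$, is the set of triples $(u,T,v)$, $u,v\in V_j$, $T\in\mathfrak l_j$, with bracket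 $[(u_1,T_1,v_1),(u_2,T_2,v_2)]=(T_1u_2-T_2u_1,[T_1,T_2]+2u_1\Box v_2-2u_2\Box v_1,-T_1^\#v_2+T_2^\#v_1)$. For $j\ge3$ the Wallach set of $\mathfrak{so}(2,j)$ is $\{0,\frac{j-2}2\}\cup(\frac{j-2}2,\infty)$. Let $\lambda$ be a non-zero element of it if $j\ge3$, and any $\lambda>0$ if $j\in\{1,2\}$. Let $\mathcal O_\lambda=\{x\in V_j:x_1^2=|x'|^2,\ x_1>0\}$ if $j\ge3$ and $\lambda=\frac{j-2}2$, and $\mathcal O_\lambda=\{x\in V_j:x_1>|x'|\}$ otherwise. Then $d\pi_\lambda^{\mathfrak{so}(2,j)}$ is the irreducible, infinitesimally unitary scalar type highest weight module of $\mathfrak{so}(2,j)$ on $\{p(x)e^{-\operatorname{tr}(x)}|_{\mathcal O_\lambda}:p\in\mathbb C[x_1,\dots,x_j]\}$ given by $d\pi_\lambda(u,0,0)=i(u|x)$, $d\pi_\lambda(0,T,0)=\partial_{T^\#x}+\frac{\lambda}{j}\operatorname{Tr}(T^\#)$, $d\pi_\lambda(0,0,v)=i(v|\mathcal B_\lambda)$. Here $\mathcal B_\lambda=\sum_{\alpha,\beta}\frac{\partial^2}{\partial x_\alpha\partial x_\beta}P(e_\alpha,e_\beta)x+\lambda\sum_\alpha\frac{\partial}{\partial x_\alpha}e_\alpha$, where $(e_\alpha)$ is an orthonormal basis of $V_j$ for $(\cdot|\cdot)$ and $x=\sum_\alpha x_\alpha e_\alpha$. The subalgebra $\mathfrak{so}(2,m)\subseteq\mathfrak{so}(2,n)$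 is the set of $(u,L(a)+D,v)$ with $u,a,v\in\{x\in V_n:x_{m+1}=\dots=x_n=0\}\cong V_m$, $L(a)$ the multiplication in $V_n$, and $D\in\mathfrak{so}(m-1)$ acting on $x_2,\dots,x_m$; it is identified with the conformal Lie algebra of $V_m$. The subalgebra $\mathfrak{so}(n-m)$ consists of elements $(0,D,0)$ with $D$ acting linearly on $x_{m+1},\dots,x_n$. $\mathcal H^k(\mathbb R^{n-m})$ is the representation of $\mathfrak{so}(n-m)$ on complex-valued harmonic homogeneous polynomials (spherical harmonics) of degree $k$ on $\mathbb R^{n-m}$ (it is zero for $k\ge2$ if $n-m=1$; for $n=m$ it is $\mathbb C$ if $k=0$ and zero otherwise). The symbol $\boxtimes$ denotes the outer tensor product, and the identity is an isomorphism of $\mathfrak h$-modules with the algebraic direct sum on the right. *)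

(* Defs.v *)
From HB Require Import structures.
From mathcomp Require Import all_boot all_order all_algebra.
From mathcomp Require Import sesquilinear.
From mathcomp Require Import complex.
From mathcomp Require Import -(notations) freeg mpoly.
From mathcomp Require Import all_classical all_reals all_analysis.

Set Implicit Arguments.
Unset Strict Implicit.
Unset Printing Implicit Defensive.

Import Order.TTheory GRing.Theory Num.Theory.
Import numFieldNormedType.Exports.

Local Open Scope classical_set_scope.
Local Open Scope ring_scope.
Local Open Scope complex_scope.

Section Jordan.
Context {R : realType}.

(* R x R^(j-1) for j >= 1; [V 0] is an unused duplicate of [V 1]. *)
Definition V (j : nat) := 'cV[R]_(1 + j.-1).

Definition tcoord j (x : V j) : R := usubmx x ord0 ord0.
Definition scoord j (x : V j) : 'cV[R]_(j.-1) := dsubmx x.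
Definition dot q (y z : 'cV[R]_q) : R := (y^T *m z) ord0 ord0.

Definition jmul j (x y : V j) : V j :=
  col_mx (tcoord x * tcoord y + dot (scoord x) (scoord y))%:M (tcoord x *: scoord y + tcoord y *: scoord x).
Definition jone j : V j := col_mx 1%:M 0.
Definition jtr j (x : V j) : R := 2 * tcoord x.
Definition jform j (x y : V j) : R := jtr (jmul x y).

Definition Lop j (x : V j) : 'M[R]_(1 + j.-1) :=
  \matrix_(i, k) jmul x (delta_mx k ord0) i ord0.
Definition Pop j (x y : V j) : 'M[R]_(1 + j.-1) :=
  Lop x *m Lop y + Lop y *m Lop x - Lop (jmul x y).
Definition box j (x y : V j) : 'M[R]_(1 + j.-1) :=
  Lop (jmul x y) + (Lop x *m Lop y - Lop y *m Lop x).

(* Since (x|y) is twice the Euclidean scalar product (see [jformE]), the adjoint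
   is the transpose and [onb] is orthonormal for the trace form. *)
Definition adj j (T : 'M[R]_(1 + j.-1)) : 'M[R]_(1 + j.-1) := T^T.
Definition onb j (i : 'I_(1 + j.-1)) : V j :=
  (Num.sqrt 2)^-1 *: delta_mx i ord0.

Lemma jmul_linear j (x : V j) : linear (jmul x).
Proof.
move=> a y z; rewrite /jmul.
have -> : tcoord (a *: y + z) = a * tcoord y + tcoord z by rewrite /tcoord !mxE.
have -> : scoord (a *: y + z) = a *: scoord y + scoord z by rewrite /scoord linearP.
have -> : dot (scoord x) (a *: scoord y + scoord z) = a * dot (scoord x) (scoord y) + dot (scoord x) (scoord z).
  by rewrite /dot mulmxDr -scalemxAr !mxE.
rewrite scale_col_mx add_col_mx; congr col_mx.
  rewrite scale_scalar_mx -raddfD /=; congr (_%:M).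
  by rewrite !mulrDr addrACA mulrCA.
by rewrite scalerDl !scalerDr !scalerA addrACA [tcoord x * a]mulrC.
Qed.

Lemma mulLE j (x y : V j) : Lop x *m y = jmul x y.
Proof.
pose f := HB.pack_for {linear V j -> V j} (jmul x)
  (GRing.isLinear.Build _ _ _ _ _ (jmul_linear x)).
apply/matrixP => i k; rewrite ord1 mxE -[jmul x y]/(f y).
rewrite [in RHS](matrix_sum_delta y) (linear_sum f) summxE.
apply: eq_bigr => l _; rewrite big_ord1 (linearZ_LR f) !mxE mulrC.
by rewrite /= [ord0]ord1.
Qed.

Lemma jformE j (x y : V j) : jform x y = 2 * dot x y.
Proof.
rewrite /jform /jtr /jmul /tcoord col_mxKu mxE eqxx mulr1n; congr (2 * _).
rewrite /dot mxE [in RHS]mxE big_split_ord /= big_ord1 !mxE.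
by congr (_ + _); apply: eq_bigr => k _; rewrite !mxE.
Qed.

Lemma adjP j (T : 'M[R]_(1 + j.-1)) (x y : V j) :
  jform (T *m x) y = jform x (adj T *m y).
Proof. by rewrite !jformE /dot /adj trmx_mul mulmxA. Qed.

Lemma onbP j (i k : 'I_(1 + j.-1)) :
  jform (onb i : V j) (onb k) = (i == k)%:R.
Proof.
rewrite jformE /dot mxE (bigD1 i) //= big1 ?addr0 => [|l /negPf li].
  rewrite !mxE !eqxx !andbT /= mulr1 !mulrA -[2 / _ / _]mulrA -invfM -expr2.
  by rewrite sqr_sqrtr // divff ?mul1r // pnatr_eq0.
by rewrite !mxE li mulr0 mul0r.
Qed.

Definition ext_so j (D : 'M[R]_(j.-1)) : 'M[R]_(1 + j.-1) := block_mx 0 0 0 D.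

Definition so (q : nat) : set 'M[R]_q := [set D | D^T = - D].

Definition str_alg (j : nat) : set 'M[R]_(1 + j.-1) :=
  [set T | exists a D, so D /\ T = ext_so D + Lop a].

Definition triple (j : nat) : Type := (V j * 'M[R]_(1 + j.-1) * V j)%type.

Definition so2 (j : nat) : set (triple j) := [set X | str_alg X.1.2].

Definition so2_bracket j (X Y : triple j) : triple j :=
  let: (u1, T1, v1) := X in let: (u2, T2, v2) := Y in
  (T1 *m u2 - T2 *m u1,
   (T1 *m T2 - T2 *m T1) + 2 *: box u1 v2 - 2 *: box u2 v1,
   - (adj T1 *m v2) + adj T2 *m v1).

End Jordan.

Section Inclusion.
Context {R : realType}.
Local Notation V := (@V R).
Local Notation triple := (@triple R).

(* The matrix of R^p -> R^q placing the coordinates at offset [s]. *)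
Definition shift_mx (s p q : nat) : 'M[R]_(q, p) :=
  \matrix_(i, k) (i == s + k :> nat)%N%:R.

Definition incV m n (x : V m) : V n :=
  col_mx (usubmx x) (shift_mx 0 _ _ *m scoord x).

Definition inc_so s p q (D : 'M[R]_p) : 'M[R]_q :=
  shift_mx s p q *m D *m (shift_mx s p q)^T.

(* D + L(a) with D in so(m-1), a in V_m is sent to D + L(a) with L(a) taken in
   V_n, to which E is added.  For [T = ext_so D + Lop a] one has [a = T *m jone] and
   [D = drsubmx (T - Lop a)]. *)
Definition incT m n (T : 'M[R]_(1 + m.-1)) (E : 'M[R]_(n - m)) :
    'M[R]_(1 + n.-1) :=
  let a : V m := T *m jone m in
  Lop (incV n a) + ext_so (inc_so 0 n.-1 (drsubmx (T - Lop a)) +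
                          inc_so m.-1 n.-1 E).

Definition inc_triple m n (X : triple m) (E : 'M[R]_(n - m)) : triple n :=
  (incV n X.1.1, incT X.1.2 E, incV n X.2).

Lemma so_inc s p q (D : 'M[R]_p) : so D -> so (inc_so s q D).
Proof.
by rewrite /so /= /inc_so => DE; rewrite !trmx_mul trmxK DE mulNmx mulmxN mulmxA.
Qed.

Lemma jmul1 j (a : V j) : jmul a (jone j) = a.
Proof.
rewrite /jmul /jone /dot /tcoord /scoord col_mxKu col_mxKd mulmx0 scaler0 add0r.
rewrite !mxE eqxx mulr1 addr0 scale1r -[RHS]vsubmxK; congr col_mx.
by rewrite [RHS]mx11_scalar mxE.
Qed.

Lemma str_algP j (T : 'M[R]_(1 + j.-1)) (a : V j) D : T = ext_so D + Lop a ->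
  T *m jone j = a /\ drsubmx (T - Lop (T *m jone j)) = D.
Proof.
move=> ->.
have -> : (ext_so D + Lop a) *m jone j = a.
  rewrite mulmxDl mulLE jmul1 /ext_so /jone mul_block_col !mul0mx mulmx0 !addr0.
  by rewrite col_mx0 add0r.
by split=> //; rewrite addrK block_mxKdr.
Qed.

Lemma so2_inc m n (X : triple m) (E : 'M[R]_(n - m)) :
  so2 X -> so E -> so2 (inc_triple X E).
Proof.
move=> [a [D [soD XE]]] soE; rewrite /so2 /inc_triple /= /incT.
have [-> ->] := str_algP XE.
exists (incV n a), (inc_so 0 n.-1 D + inc_so m.-1 n.-1 E).
split; last by rewrite addrC.
by rewrite /so /= linearD /= !so_inc // opprD.
Qed.

Definition h_alg (m n : nat) : Type := (@so2 R m * @so R (n - m))%type.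

Definition inc m n (Z : h_alg m n) : @so2 R n :=
  exist _ (inc_triple (val Z.1) (val Z.2))
    (mem_set (so2_inc (set_mem (valP Z.1)) (set_mem (valP Z.2)))).

End Inclusion.

Section ScalarType.
Context {R : realType}.
Local Notation V := (@V R).
Local Notation triple := (@triple R).

Definition dderiv j (v : V j) (F : V j -> R[i]) : V j -> R[i] := fun x =>
  'D_v (fun y => complex.Re (F y)) x +i* 'D_v (fun y => complex.Im (F y)) x.

(* (v | B_lambda) F, where the second order coefficients P(e_a, e_b)x are not
   differentiated. *)
Definition bessel j (lambda : R) (v : V j) (F : V j -> R[i]) : V j -> R[i] :=
  fun x =>
    (\sum_a \sum_b (jform v (Pop (onb a) (onb b : V j) *m x))%:C
                     * dderiv (onb a) (dderiv (onb b) F) x)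
    + lambda%:C * (\sum_a (jform v (onb a))%:C * dderiv (onb a) F x).

Definition dpi_fun j (lambda : R) (X : triple j) (F : V j -> R[i]) :
    V j -> R[i] := fun x =>
  let: (u, T, v) := X in
  'i * (jform u x)%:C * F x
  + (dderiv (adj T *m x) F x + (lambda / j%:R * \tr (adj T))%:C * F x)
  + 'i * bessel lambda v F x.

(* The Wallach point (j-2)/2 gives the light cone, other values the open cone. *)
Definition orbit j (lambda : R) : set (V j) :=
  [set x | if (3 <= j)%N && (lambda == (j%:R - 2) / 2)
           then tcoord x ^+ 2 = dot (scoord x) (scoord x) /\ 0 < tcoord x
           else Num.sqrt (dot (scoord x) (scoord x)) < tcoord x].

#[global] Arguments orbit j lambda : clear implicits.

Definition polexp j (p : mpoly (1 + j.-1) R[i]) : V j -> R[i] := fun x =>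
  meval (fun i => (x i ord0)%:C) p * (expR (- jtr x))%:C.

Section Carrier.
Variables (j : nat) (lambda : R).

Definition hw_pred : {pred (orbit j lambda -> R[i]^o)} := fun f =>
  `[< exists p : mpoly (1 + j.-1) R[i], forall x, f x = polexp p (val x) >].

Lemma hw_pred_submod : submod_closed hw_pred.
Proof.
split=> [|c f g /asboolP[p fE] /asboolP[q gE]]; apply/asboolP.
  by exists 0 => x; rewrite /polexp meval0 mul0r.
exists (c *: p + q) => x; rewrite /polexp mevalD mevalZ mulrDl -mulrA.
by rewrite -[LHS]/(c * f x + g x) fE gE.
Qed.

HB.instance Definition _ :=
  GRing.isSubmodClosed.Build R[i] (orbit j lambda -> R[i]^o) hw_pred
    hw_pred_submod.

Record hw_space := HwSpace {
  hw_val :> orbit j lambda -> R[i]^o ;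
  hw_valP : hw_val \in hw_pred }.

HB.instance Definition _ := [isSub for hw_val].
HB.instance Definition _ := [Choice of hw_space by <:].
HB.instance Definition _ := [SubChoice_isSubLmodule of hw_space by <:].

(* [f] is extended to all of V_j as some p(x)exp(-tr x), the differential
   operator is applied, and the result is restricted to the orbit again.  When
   the orbit is the light cone such an extension is not unique, but for that
   value of lambda the operators are tangential to the cone: the result is the
   same for every extension, which is how it is characterised here. *)
Definition dpi_act (X : @so2 R j) (f : hw_space) : hw_space :=
  xget 0 [set g : hw_space | forall p : mpoly (1 + j.-1) R[i],
    (forall x : orbit j lambda, f x = polexp p (val x)) ->
    forall x : orbit j lambda,
      g x = dpi_fun lambda (val X) (polexp p) (val x)].

End Carrier.
End ScalarType.

Section Harmonics.
Context {R : realType}.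
Variables (q k : nat).
Local Notation poly := (mpoly q R[i]).

Definition laplacian (h : poly) : poly := \sum_(i < q) mderiv i (mderiv i h).

Definition harm_pred : {pred poly} :=
  fun h => (h \is ishomog1 k mdeg) && (laplacian h == 0).

Lemma harm_pred_submod : submod_closed harm_pred.
Proof.
split=> [|c g h /andP[gk /eqP g0] /andP[hk /eqP h0]]; apply/andP; split.
- exact: rpred0.
- by rewrite /laplacian big1 // => i _; rewrite !mderiv0.
- by apply: rpredD => //; apply: rpredZ.
rewrite /laplacian; under eq_bigr do rewrite !mderivD !mderivZ.
by rewrite big_split -scaler_sumr /= -/(laplacian g) -/(laplacian h) g0 h0
           scaler0 addr0.
Qed.

HB.instance Definition _ :=
  GRing.isSubmodClosed.Build R[i] poly harm_pred harm_pred_submod.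

Record harm_space := HarmSpace {
  harm_val :> poly ;
  harm_valP : harm_val \in harm_pred }.

HB.instance Definition _ := [isSub for harm_val].
HB.instance Definition _ := [Choice of harm_space by <:].
HB.instance Definition _ := [SubChoice_isSubLmodule of harm_space by <:].

(* The derivative of h at y along D^T y = - D y, i.e. of h(exp(-tD)y) at
   t = 0. *)
Definition rot (D : 'M[R]_q) (h : poly) : poly :=
  \sum_(i < q) \sum_(l < q)
    (D^T i l)%:C *: (mpolyX _ (mnm1 l) * mderiv i h).

Lemma mderiv_homog (i l : 'I_q) (h : poly) : h \is ishomog1 k mdeg ->
  mpolyX _ (mnm1 l) * mderiv i h \is ishomog1 k mdeg.
Proof.
move=> hk; have [->|nz] := eqVneq (mderiv i h) 0; first by rewrite mulr0 rpred0.
have dk m : m \in msupp (mderiv i h) -> (mdeg m).+1 = k.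
  rewrite mcoeff_msupp mcoeff_deriv => mh.
  have : mnm_add m (mnm1 i) \in msupp h.
    by rewrite mcoeff_msupp; apply: contra_neq mh => ->; rewrite mul0rn.
  by move=> /(dhomog_mf hk) /=; rewrite mdegD mdeg1 addn1.
rewrite -(dk _ (mlead_supp nz)) -add1n; apply: dhomogM.
  by rewrite dhomogX /= mdeg1.
by apply/dhomogP => m /dk /=; rewrite -(dk _ (mlead_supp nz)) => -[].
Qed.

Lemma laplacianXM (l : 'I_q) (h : poly) :
  laplacian (mpolyX _ (mnm1 l) * h) =
  mderiv l h *+ 2 + mpolyX _ (mnm1 l) * laplacian h.
Proof.
have dX i : mderiv i (mpolyX R[i] (mnm1 l)) = (l == i)%:R.
  rewrite mderivX mnm1E; case: eqVneq => [->|_]; last by rewrite scale0r.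
  by rewrite -[X in mnm_sub X _]add0m addmK scale1r mpolyX0.
rewrite /laplacian mulr_sumr -[RHS]/(_ + _).
under eq_bigr => i _ do
  rewrite mderivM dX mderivD mderivM dX !mulr_natl mderivMn addrA -mulr2n.
rewrite big_split /= (bigD1 l) //= eqxx mulr1n big1 ?addr0 // => i.
by rewrite eq_sym => /negPf ->; rewrite mul0rn.
Qed.

Lemma rot_harm (D : @so R q) (h : harm_space) : rot (val D) h \in harm_pred.
Proof.
case: h => h /= /andP[hk /eqP h0]; apply/andP; split.
  by do 2!apply: rpred_sum => ? _; apply: rpredZ; apply: mderiv_homog.
have lapS I (r : seq I) (F : I -> poly) :
    laplacian (\sum_(i <- r) F i) = \sum_(i <- r) laplacian (F i).
  rewrite /laplacian [RHS]exchange_big; apply: eq_bigr => i _.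
  transitivity (mderiv i (\sum_(l <- r) mderiv i (F l))); last exact: raddf_sum.
  by congr mderiv; exact: raddf_sum.
have lapd i : laplacian (mderiv i h) = 0.
  rewrite -(mderiv0 _ i) -h0 /laplacian.
  transitivity (\sum_(l < q) mderiv i (mderiv l (mderiv l h))); last by symmetry; exact: raddf_sum.
  apply: eq_bigr => l _.
  by rewrite (mderiv_comm i l h) (mderiv_comm i l).
have DT i l : (val D)^T l i = - (val D)^T i l.
  have DE : (val D)^T = - val D := set_mem (valP D).
  by rewrite {1}DE !mxE.
have -> : laplacian (rot (val D) h) =
    \sum_(i < q) \sum_(l < q) ((val D)^T i l)%:C *: (mderiv l (mderiv i h) *+ 2).
  rewrite /rot lapS; apply: eq_bigr => i _; rewrite lapS; apply: eq_bigr => l _.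
  rewrite /laplacian; under eq_bigr do rewrite !mderivZ.
  rewrite -scaler_sumr -/(laplacian _); congr (_ *: _).
  by rewrite laplacianXM lapd mulr0 addr0.
set S := (X in X == _); suff S0 : S = - S.
  have : (2%:R : R[i]) *: S = 0 by rewrite scaler_nat mulr2n {1}S0 addNr.
  by move/eqP; rewrite scaler_eq0 pnatr_eq0.
rewrite {1}/S exchange_big /= -sumrN; apply: eq_bigr => i _.
rewrite -sumrN; apply: eq_bigr => l _.
by rewrite DT mderiv_comm rmorphN scaleNr opprK.
Qed.

Definition harm_act (D : @so R q) (h : harm_space) : harm_space :=
  HarmSpace (rot_harm D h).

End Harmonics.

Section Modules.
Context {C : nzRingType}.

(* A C-module with one operator for each element of g.  The bracket of g is not
   recorded: it plays no role in the notion of isomorphism. *)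
Record gmod (g : Type) := GMod {
  carrier :> lmodType C ;
  act : g -> carrier -> carrier }.

Definition gres (g h : Type) (i : h -> g) (W : gmod g) : gmod h :=
  GMod (fun X : h => act (i X) : W -> W).

Definition is_tensor (A B T : lmodType C) (t : {bilinear A -> B -> T}) : Prop :=
  forall (M : lmodType C) (b : {bilinear A -> B -> M}),
    exists f : {linear T -> M},
      (forall x y, f (t x y) = b x y) /\
      (forall f' : {linear T -> M}, (forall x y, f' (t x y) = b x y) -> f' =1 f).

(* T is an outer tensor product of A and B.  Every element of T is a finite sum
   of pure tensors, so the last condition determines the operators on T; it is
   stated on sums because [act X] is not linear by construction. *)
Definition is_outer_tensor (g1 g2 : Type) (A : gmod g1) (B : gmod g2)
    (T : gmod (g1 * g2)) : Prop :=
  exists2 t : {bilinear A -> B -> T}, is_tensor t &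
    forall (X : g1 * g2) (N : nat) (x : 'I_N -> A) (y : 'I_N -> B),
      act X (\sum_i t (x i) (y i)) =
      \sum_i (t (act X.1 (x i)) (y i) + t (x i) (act X.2 (y i))).

Definition is_direct_sum (g : Type) (M : nat -> gmod g) (W : gmod g) : Prop :=
  exists i : forall k, {linear M k -> W},
  [/\ forall w, exists (N : nat) (x : forall k, M k), w = \sum_(k < N) i k (x k),
      forall (N : nat) (x : forall k, M k), \sum_(k < N) i k (x k) = 0 ->
        forall k, (k < N)%N -> x k = 0
    & forall (X : g) (N : nat) (x : forall k, M k),
        act X (\sum_(k < N) i k (x k)) = \sum_(k < N) i k (act X (x k))].

End Modules.

Definition dpi (R : realType) (j : nat) (lambda : R) : gmod (@so2 R j) :=
  GMod (@dpi_act R j lambda).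
Definition harmonics (R : realType) (q k : nat) : gmod (@so R q) :=
  GMod (@harm_act R q k).

(* Main.v *)
(** Write a point of V_n as x = (y, z) with y in V_m and z in R^(n-m), so that the
    light cone is |z|^2 = Delta(y) with Delta(y) = y_1^2 - |y'|^2.  The intertwiner
    sends p(y) exp(-tr y) (x) h(z), with h harmonic homogeneous of degree k, to the
    restriction of p(y) h(z) exp(-tr x) to the light cone.
    - Equivariance is a polynomial identity: Euler's formula for h shifts lambda by
      k, and harmonicity of h removes the z-part of the wave operator that occurs
      in the Bessel operator
        (v|B_lambda) = sum_(a,b) x_a v_b d_a d_b - (v.Jx)/2 Box + lambda (v.d),
      where J changes the sign of the last j - 1 coordinates.
    - Surjectivity is Fischer's decomposition of polynomials in z into products of
      powers of |z|^2 and harmonic polynomials, as |z|^2 = Delta(y) on the cone.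
    - Injectivity: for fixed y in the open cone, z runs over a sphere, and harmonic
      polynomials of distinct degrees are linearly independent on a sphere.
    The same two facts with m = 1 show that a polynomial vanishing on the light
    cone of V_n is a multiple of Delta; hence the operators are tangential to the
    cone for lambda = (n-2)/2. *)

From HB Require Import structures.
Require Import Defs.
From mathcomp Require Import all_boot all_order all_algebra.
From mathcomp Require Import sesquilinear complex ring zify.
From mathcomp Require Import -(notations) freeg mpoly.
From mathcomp Require Import all_classical all_reals all_analysis.

Set Implicit Arguments.
Unset Strict Implicit.
Unset Printing Implicit Defensive.

Import Order.TTheory GRing.Theory Num.Theory.
Import numFieldNormedType.Exports.

Local Open Scope ring_scope.

Local Open Scope complex_scope.

(** The vectors of the modules are functions on orbits, and a polynomial that represents one is
    determined only up to polynomials vanishing on the orbit. Computations are therefore made with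
    polynomials, as identities between values at points, and [dpoly_orbit] is what allows the return
    to functions. The Fischer decomposition is obtained without an inner product or integration: the
    commutator of the Laplacian with |z|^2 shows by induction on the degree that |z|^2 times the
    Laplacian has no negative eigenvalue, so the Laplacian after multiplication by |z|^2 is an
    injective endomorphism of a finite-dimensional space. The case m = n is degenerate: there is no
    sphere to vary z on, the orbit in V_m for k = 0 is the light cone itself, and the spaces of
    harmonics of positive degree are zero. The intertwiner is shown to be well defined and injective
    separately in this case. *)

Local Notation orbit := Defs.orbit.

(** * Harmonic polynomials *)

Section Fischer.
Variable R : realType.
Local Notation C := R[i].
Local Notation X := (fun l => mpolyX C (mnm1 l)).

Definition rsq q : mpoly q C := \sum_(l < q) X l * X l.

Definition euler q (g : mpoly q C) := \sum_(l < q) X l * mderiv l g.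

Lemma homog_ind q d (P : mpoly q C -> Prop) :
  P 0 -> (forall g h, P g -> P h -> P (g + h)) ->
  (forall c g, P g -> P (c *: g)) ->
  (forall mo, mdeg mo = d -> P (mpolyX C mo)) ->
  forall g, g \is ishomog1 d mdeg -> P g.
Proof.
move=> P0 PD PZ PX g /dhomogP gd; rewrite (mpolyE g) big_seq.
by elim/big_ind: _ => // mo /gd mod; apply: PZ; apply: PX.
Qed.

Lemma mpoly_lin_ind q (P : mpoly q C -> Prop) :
  P 0 -> (forall g h, P g -> P h -> P (g + h)) ->
  (forall c g, P g -> P (c *: g)) ->
  (forall mo, P (mpolyX C mo)) -> forall g, P g.
Proof.
move=> P0 PD PZ PX g; rewrite (mpolyE g).
by elim/big_ind: _ => // mo _; apply: PZ; apply: PX.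
Qed.

Lemma mpoly_ring_ind q (P : mpoly q C -> Prop) :
  (forall c, P (mpolyC q c)) -> (forall i, P (X i)) ->
  (forall g h, P g -> P h -> P (g + h)) ->
  (forall g h, P g -> P h -> P (g * h)) -> forall g, P g.
Proof.
move=> PC PX PD PM; apply: mpoly_lin_ind => [|//|c p Pp|mo].
- by rewrite -(mpolyC0 q).
- by rewrite -mul_mpolyC; apply: PM.
have P1 : P 1 by have := PC 1; rewrite mpolyC1.
rewrite mpolyXE_id; elim/big_ind: _ => // i _; elim: (mo i) => [//|k IH].
by rewrite exprS; apply: PM.
Qed.

Lemma mderivXX q (i l : 'I_q) : mderiv i (X l) = (l == i)%:R.
Proof.
rewrite mderivX mnm1E; case: eqVneq => [->|_]; last by rewrite scale0r.
by rewrite -[X in mnm_sub X _]add0m addmK scale1r mpolyX0.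
Qed.

Lemma eulerE q d (g : mpoly q C) : g \is ishomog1 d mdeg -> euler g = d%:R *: g.
Proof.
move: g; apply: homog_ind => [|g h gE hE|c g gE|mo <-].
- by rewrite scaler0 /euler big1 // => l _; rewrite mderiv0 mulr0.
- rewrite scalerDr -gE -hE /euler -big_split /=.
  by apply: eq_bigr => l _; rewrite mderivD mulrDr.
- rewrite scalerA mulrC -scalerA -gE /euler scaler_sumr.
  by apply: eq_bigr => l _; rewrite mderivZ scalerAr.
rewrite /euler mdegE natr_sum scaler_suml; apply: eq_bigr => l _.
rewrite mderivX -scalerAr -mpolyXD; case E: (mo l) => [|c].
  by rewrite !scale0r.
by congr (_ *: mpolyX _ _); apply/mnmP => i; rewrite mnmDE mnmBE mnm1E;
   case: eqP => [<-|_] /=; lia.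
Qed.

Lemma lapD q (g h : mpoly q C) : laplacian (g + h) = laplacian g + laplacian h.
Proof.
rewrite /laplacian -big_split; apply: eq_bigr => l _ /=.
by rewrite !mderivD.
Qed.

Lemma lapZ q c (g : mpoly q C) : laplacian (c *: g) = c *: laplacian g.
Proof.
by rewrite /laplacian scaler_sumr; apply: eq_bigr => l _; rewrite !mderivZ.
Qed.

Lemma lap0 q : laplacian (0 : mpoly q C) = 0.
Proof. by rewrite /laplacian big1 // => l _; rewrite !mderiv0. Qed.

Lemma lap_sum q I r (F : I -> mpoly q C) :
  laplacian (\sum_(i <- r) F i) = \sum_(i <- r) laplacian (F i).
Proof. by elim/big_rec2: _ => [|i y1 y2 _ <-]; rewrite ?lap0 ?lapD. Qed.

(** The commutator of the Laplacian with multiplication by |z|^2 is 4 [euler] + 2q, which Euler's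
    formula turns into a scalar in degree d. *)
Lemma lap_rsqM q d (g : mpoly q C) : g \is ishomog1 d mdeg ->
  laplacian (rsq q * g) = (q.*2 + 4 * d)%N%:R *: g + rsq q * laplacian g.
Proof.
move=> gd; rewrite {1}/rsq mulr_suml lap_sum.
rewrite (eq_bigr (fun l => 2%:R *: g + 4%:R *: (X l * mderiv l g)
                          + X l * X l * laplacian g)); last first.
  move=> l _; rewrite -mulrA !laplacianXM mderivM mderivX mnm1E eqxx.
  have -> : mnm_sub (mnm1 l) (mnm1 l) = @mnm0 q.
    by apply/mnmP => i; rewrite mnmBE mnm0E subnn.
  rewrite mpolyX0 scale1r mul1r !scaler_nat.
  ring.
rewrite !big_split /= sumr_const card_ord -scaler_sumr -/(euler g) (eulerE gd).
rewrite -mulr_suml -/(rsq q); congr (_ + _).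
by rewrite -scaler_nat !scalerA -scalerDl -!natrM -natrD; congr (_%:R *: _); lia.
Qed.

Lemma mderiv_dhomog q d l (g : mpoly q C) : g \is ishomog1 d mdeg ->
  mderiv l g \is ishomog1 d.-1 mdeg.
Proof.
move: g; apply: homog_ind => [|g h gE hE|c g gE|mo modeg].
- by rewrite mderiv0 rpred0.
- by rewrite mderivD rpredD.
- by rewrite mderivZ rpredZ.
rewrite mderivX; case E: (mo l) => [|c]; first by rewrite scale0r rpred0.
rewrite rpredZ // dhomogX /=.
have moE : mo = mnm_add (mnm_sub mo (mnm1 l)) (mnm1 l).
  apply/mnmP => i; rewrite mnmDE mnmBE mnm1E.
  by case: eqP => [<-|_] /=; lia.
by rewrite -modeg [in X in _ == X]moE mdegD mdeg1 addn1.
Qed.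

Lemma lap_dhomog q d (g : mpoly q C) : g \is ishomog1 d mdeg ->
  laplacian g \is ishomog1 d.-2 mdeg.
Proof. by move=> gd; apply: rpred_sum => l _; do 2!apply: mderiv_dhomog. Qed.

Lemma mderiv_dhomog0 q l (g : mpoly q C) : g \is ishomog1 0 mdeg -> mderiv l g = 0.
Proof.
move: g; apply: homog_ind => [|g h gE hE|c g gE|mo modeg].
- by rewrite mderiv0.
- by rewrite mderivD gE hE addr0.
- by rewrite mderivZ gE scaler0.
have -> : mo = @mnm0 q by apply/eqP; rewrite -mdeg_eq0 modeg.
by rewrite mpolyX0 mderivC.
Qed.

Lemma lap_dhomog_lt2 q d (g : mpoly q C) : (d < 2)%N -> g \is ishomog1 d mdeg ->
  laplacian g = 0.
Proof.
move=> d2 gd; rewrite /laplacian big1 // => l _; apply: mderiv_dhomog0.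
by have := mderiv_dhomog l gd; case: d d2 {gd} => [|[|]].
Qed.

Lemma rsq_dhomog q : rsq q \is ishomog1 2 mdeg.
Proof.
apply: rpred_sum => l _; apply: (dhomogM (d := 1) (e := 1));
by rewrite dhomogX /= mdeg1.
Qed.

Lemma rsqM_dhomog q d (g : mpoly q C) : g \is ishomog1 d mdeg ->
  rsq q * g \is ishomog1 d.+2 mdeg.
Proof. by move=> gd; apply: (dhomogM (d := 2)); rewrite ?rsq_dhomog. Qed.

Lemma rsq_neq0 q : (0 < q)%N -> rsq q != 0.
Proof.
case: q => // q _; apply/eqP => /(congr1 (meval (fun i => (i == ord0)%:R))).
rewrite meval0 /rsq raddf_sum (bigD1 ord0) //= big1 => [|i /negPf i0].
  by rewrite mevalM mevalXU eqxx mulr1 addr0 => /eqP; rewrite oner_eq0.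
by rewrite mevalM mevalXU i0 mulr0.
Qed.

(* [r^2 Delta] has no negative eigenvalue on homogeneous polynomials: if
   [r^2 Delta g = - c g] then [g = r^2 h] and [h] is an eigenvector of degree
   [d - 2] for an even smaller eigenvalue. *)
Lemma rsq_lap_eig q d c (g : mpoly q C) : (0 < c)%N -> g \is ishomog1 d mdeg ->
  rsq q * laplacian g = - (c%:R *: g) -> g = 0.
Proof.
have [q0 c0 _|q0] := posnP q.
  move/eqP; rewrite /laplacian big1 => [|l _]; last by case: l => l Hl; exfalso; lia.
  rewrite mulr0 eq_sym oppr_eq0 scaler_eq0.
  by rewrite pnatr_eq0 (gtn_eqF c0) => /eqP.
elim/ltn_ind: d c g => d IH c g c0 gd gE.
have c0' : c%:R != 0 :> C by rewrite pnatr_eq0 -lt0n.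
have [d2|d2] := ltnP d 2.
  move/eqP: gE; rewrite (lap_dhomog_lt2 d2 gd) mulr0 eq_sym oppr_eq0 scaler_eq0.
  by rewrite (negPf c0') => /eqP.
pose h := - c%:R^-1 *: laplacian g.
have gh : g = rsq q * h.
  rewrite /h -scalerAr gE scalerN scaleNr opprK scalerA mulVf ?scale1r //.
have hd : h \is ishomog1 d.-2 mdeg by rewrite rpredZ // lap_dhomog.
suff h0 : h = 0 by rewrite gh h0 mulr0.
(* Moving the Laplacian past |z|^2 in g = |z|^2 h adds 2q + 4(d-2) to c, by [lap_rsqM]; the factor
   |z|^2 is then cancelled. *)
apply: (IH d.-2 _ (c + (q.*2 + 4 * d.-2))%N h _ hd); [lia|lia|].
have : rsq q * (laplacian g + c%:R *: h) = 0.
  by rewrite mulrDr gE -scalerAr -gh addNr.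
move/eqP; rewrite mulf_eq0 (negPf (rsq_neq0 q0)) /= gh (lap_rsqM hd).
by rewrite addrAC -scalerDl -natrD addnC addr_eq0 => /eqP ->; rewrite opprK.
Qed.

(** By [lap_rsqM] such a g would be an eigenvector of |z|^2 times the Laplacian for -(2q + 4d),
    which is negative as q > 0. *)
Lemma lap_rsq_inj q d (g : mpoly q C) : (0 < q)%N -> g \is ishomog1 d mdeg ->
  laplacian (rsq q * g) = 0 -> g = 0.
Proof.
move=> q0 gd; rewrite (lap_rsqM gd) => /eqP.
rewrite addrC addr_eq0 => /eqP; apply: rsq_lap_eig gd; lia.
Qed.

(** An injective endomorphism of the finite-dimensional space of homogeneous polynomials of degree d
    is onto. *)
Lemma lap_rsq_surj q d (g : mpoly q C) : (0 < q)%N -> g \is ishomog1 d mdeg ->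
  exists2 h, h \is ishomog1 d mdeg & laplacian (rsq q * h) = g.
Proof.
case: q g => // q g _ gd.
pose f (h : dhomog q.+1 C d) : dhomog q.+1 C d :=
  DHomog (lap_dhomog (rsqM_dhomog (dhomog_is_dhomog h))).
have f_lin : linear f.
  by move=> c h1 h2; apply/val_inj; rewrite /= mulrDr lapD -scalerAr lapZ.
pose F := HB.pack_for {linear dhomog q.+1 C d -> dhomog q.+1 C d} f
  (GRing.isLinear.Build _ _ _ _ _ f_lin).
have kF : lker (linfun F) == 0%VS.
  apply/eqP/vspaceP => h; rewrite memv_ker lfunE memv0; apply/eqP/eqP => [|->].
    move/(congr1 val) => /= /lap_rsq_inj h0; apply/val_inj.
    by apply: (h0 d) => //; exact: dhomog_is_dhomog.
  exact: raddf0.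
pose h := ((linfun F)^-1)%VF (DHomog gd).
exists (val h); first exact: dhomog_is_dhomog.
have /(congr1 val) := lker0_lfunVK kF (DHomog gd).
by rewrite lfunE.
Qed.

(** With g' chosen so that |z|^2 g' has the same Laplacian as g, the difference is harmonic. Degrees
    below 2 form the first alternative, since there [d.-2] is truncated and g is harmonic already;
    so does q = 0. *)
Lemma fischer q d (g : mpoly q C) : g \is ishomog1 d mdeg ->
  g \in @harm_pred R q d \/
  exists h g', [/\ h \in @harm_pred R q d, g' \is ishomog1 d.-2 mdeg, (2 <= d)%N
     & g = h + rsq q * g'].
Proof.
move=> gd; have [d2|d2] := ltnP d 2.
  by left; apply/andP; split=> //; rewrite (lap_dhomog_lt2 d2 gd).
have [q0|q0] := posnP q.
  left; apply/andP; split=> //; rewrite /laplacian big1 //.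
  by case=> l Hl; exfalso; lia.
right; have [g' g'd g'E] := lap_rsq_surj q0 (lap_dhomog gd).
exists (g - rsq q * g'), g'; split=> //; last by rewrite subrK.
apply/andP; split; last by rewrite lapD -scaleN1r lapZ g'E scaleN1r subrr.
by apply: rpredB => //; case: d d2 g'd {gd g'E} => [|[|d]] // _ /rsqM_dhomog.
Qed.

End Fischer.

(** * Finite bases of the spaces of spherical harmonics *)

Section Basis.
Variable R : realType.
Local Notation C := R[i].

(** Finite dimension of a bare module, recorded by coordinate forms: [bcoordK] says that the vectors
    generate, [bcoord_sum] that they are free. *)
Record fin_basis (L : lmodType C) := FinBasis {
  bdim : nat;
  bvec : 'I_bdim -> L;
  bcoord : 'I_bdim -> L -> C;
  bcoord_lin : forall i, scalar (bcoord i);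
  bcoordK : forall x, \sum_i bcoord i x *: bvec i = x;
  bcoord_sum : forall c j, bcoord j (\sum_i c i *: bvec i) = c j }.


Lemma embed_basis (L : lmodType C) (W : vectType C) (f : {linear L -> W})
    (U : {vspace W}) : injective f -> (forall x, f x \in U) ->
  (forall w, w \in U -> exists x, f x = w) -> inhabited (fin_basis L).
Proof.
move=> f_inj fU Uf; pose b := vbasis U.
have /choice[h hE] (i : 'I_(\dim U)) : exists x, f x = b`_i.
  by apply: Uf; rewrite vbasis_mem // mem_nth // size_tuple.
split; apply: (@FinBasis L (\dim U) h (fun i x => coord b i (f x))).
- by move=> i c x y; rewrite !linearP.
- move=> x; apply: f_inj; rewrite [RHS](coord_vbasis (fU x)) linear_sum.
  by apply: eq_bigr => i _; rewrite linearZ /= hE.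
move=> c j; rewrite linear_sum linear_sum (bigD1 j) //= big1 => [|i ij].
  by rewrite !linearZ /= hE coord_free ?(basis_free (vbasisP U)) // eqxx mulr1 addr0.
by rewrite !linearZ /= hE coord_free ?(basis_free (vbasisP U)) // (negPf ij) mulr0.
Qed.

(** For q > 0 the harmonic polynomials are the kernel of |z|^2 times the Laplacian: the factor |z|^2
    is cancellable, and it makes the map an endomorphism of the homogeneous polynomials of degree k.
    For q = 0 all polynomials are constants, so the space is C if k = 0 and zero otherwise. *)
Lemma harm_basis_ex q k : inhabited (fin_basis (@harm_space R q k)).
Proof.
case: q => [|q].
  pose f (h : @harm_space R 0 k) : C^o := mcoeff (@mnm0 0) (val h).
  have f_lin : linear f by move=> c x y; rewrite /f /= mcoeffD mcoeffZ.
  pose F := HB.pack_for {linear @harm_space R 0 k -> C^o} f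
    (GRing.isLinear.Build _ _ _ _ _ f_lin).
  have F_inj : injective F.
    by move=> x y /(congr1 (@mpolyC 0 C)); rewrite !mpolyKC => /val_inj.
  have [k0|k0] := posnP k.
    apply: (@embed_basis _ _ F fullv F_inj) => [x|w _]; first exact: memvf.
    have w1 : mpolyC 0 w \in @harm_pred R 0 k.
      apply/andP; split; last by rewrite /laplacian big_ord0.
      by rewrite k0 nvar0_homog.
    by exists (HarmSpace w1); rewrite /= /f /= mcoeffC eqxx mulr1.
  apply: (@embed_basis _ _ F 0%VS F_inj) => [x|w].
    case: x => x /= xk; rewrite /f /= memv0; apply/eqP.
    by case/andP: xk => /dhomog_nemf_coeff -> //=; rewrite mdeg0 eq_sym -lt0n.
  by rewrite memv0 => /eqP ->; exists 0; rewrite raddf0.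
have e_homog (h : @harm_space R q.+1 k) : val h \is ishomog1 k mdeg.
  by case: h => h /= /andP[].
pose f (h : @harm_space R q.+1 k) : dhomog q.+1 C k := DHomog (e_homog h).
have f_lin : linear f by move=> c x y; apply/val_inj.
pose F := HB.pack_for {linear @harm_space R q.+1 k -> dhomog q.+1 C k} f
  (GRing.isLinear.Build _ _ _ _ _ f_lin).
have g_homog (h : dhomog q.+1 C k) :
    rsq R q.+1 * laplacian (val h) \is ishomog1 k mdeg.
  have hk := dhomog_is_dhomog h; have [k2|k2] := ltnP k 2.
    by rewrite (lap_dhomog_lt2 k2 hk) mulr0 rpred0.
  by have /rsqM_dhomog := lap_dhomog hk; rewrite -addn2 -subn2 subnK.
pose g (h : dhomog q.+1 C k) : dhomog q.+1 C k := DHomog (g_homog h).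
have g_lin : linear g.
  by move=> c x y; apply/val_inj; rewrite /= lapD lapZ mulrDr scalerAr.
pose G := HB.pack_for {linear dhomog q.+1 C k -> dhomog q.+1 C k} g
  (GRing.isLinear.Build _ _ _ _ _ g_lin).
apply: (@embed_basis _ _ F (lker (linfun G))) => [x y /(congr1 val)|x|w].
- by move=> /= /val_inj.
- rewrite memv_ker lfunE; apply/eqP/val_inj => /=.
  by case: x => x /= /andP[_ /eqP ->]; rewrite mulr0.
rewrite memv_ker lfunE => /eqP /(congr1 val) /= /eqP.
rewrite mulf_eq0 (negPf (rsq_neq0 _ _)) //= => w0.
have wh : val w \in @harm_pred R q.+1 k.
  by apply/andP; split=> //; exact: dhomog_is_dhomog.
by exists (HarmSpace wh); apply/val_inj.
Qed.

Definition harm_basis q k : fin_basis (@harm_space R q k) :=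
  inhabited_witness (harm_basis_ex q k).

End Basis.

(** * Differential operators on polynomials times exp(- tr) *)

Section Derivatives.
Variable R : realType.
Local Notation C := R[i].
Local Notation Re := complex.Re.
Local Notation Im := complex.Im.

(* Locked: otherwise unification compares evaluations by unfolding them. *)
Fact pev_key : unit. Proof. exact: tt. Qed.
Definition pev N (p : mpoly N C) (x : 'cV[R]_N) : C :=
  locked_with pev_key (meval (fun i => (x i ord0)%:C)) p.

Lemma pevE N (p : mpoly N C) (x : 'cV[R]_N) :
  pev p x = meval (fun i => (x i ord0)%:C) p.
Proof. by rewrite /pev unlock. Qed.

Lemma pevC N c x : pev (mpolyC N c) x = c.
Proof. by rewrite pevE mevalC. Qed.
Lemma pevD N (p q : mpoly N C) x : pev (p + q) x = pev p x + pev q x.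
Proof. by rewrite !pevE mevalD. Qed.
Lemma pevN N (p : mpoly N C) x : pev (- p) x = - pev p x.
Proof. by rewrite !pevE mevalN. Qed.
Lemma pevB N (p q : mpoly N C) x : pev (p - q) x = pev p x - pev q x.
Proof. by rewrite pevD pevN. Qed.
Lemma pevM N (p q : mpoly N C) x : pev (p * q) x = pev p x * pev q x.
Proof. by rewrite !pevE mevalM. Qed.
Lemma pevXn N (p : mpoly N C) k x : pev (p ^+ k) x = pev p x ^+ k.
Proof. by rewrite !pevE rmorphXn. Qed.
Lemma pevZ N c (p : mpoly N C) x : pev (c *: p) x = c * pev p x.
Proof. by rewrite !pevE mevalZ. Qed.
Lemma pev0 N x : pev (0 : mpoly N C) x = 0.
Proof. by rewrite pevE meval0. Qed.
Lemma pev1 N x : pev (1 : mpoly N C) x = 1.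
Proof. by rewrite pevE meval1. Qed.
Lemma pev_sum N I r (P : pred I) (F : I -> mpoly N C) x :
  pev (\sum_(i <- r | P i) F i) x = \sum_(i <- r | P i) pev (F i) x.
Proof. by rewrite pevE raddf_sum; apply: eq_bigr => i _; rewrite pevE. Qed.
Lemma pevX N (i : 'I_N) x : pev (mpolyX C (mnm1 i)) x = (x i ord0)%:C.
Proof. by rewrite pevE mevalXU. Qed.

Lemma polexpE j (p : mpoly (1 + j.-1) C) (x : V j) :
  polexp p x = pev p x * (expR (- jtr x))%:C.
Proof. by rewrite pevE. Qed.

Definition is_cderive (W : normedModType R) (x v : W) (F : W -> C) (d : C) :=
  is_derive x v (fun y => Re (F y)) (Re d) /\
  is_derive x v (fun y => Im (F y)) (Im d).

Lemma is_derive_congr (W : normedModType R) (x v : W) (f : W -> R) d d' :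
  is_derive x v f d -> d = d' -> is_derive x v f d'.
Proof. by move=> + <-. Qed.

Section Rules.
Variables (W : normedModType R) (v : W).

Lemma is_cderive_eq x F d d' : is_cderive x v F d -> d = d' ->
  is_cderive x v F d'.
Proof. by move=> + <-. Qed.

Lemma is_cderive_cst x c : is_cderive x v (fun=> c) 0.
Proof. by split; exact: is_derive_cst. Qed.

Lemma is_cderiveD x F G d e : is_cderive x v F d -> is_cderive x v G e ->
  is_cderive x v (fun y => F y + G y) (d + e).
Proof.
move=> [F1 F2] [G1 G2]; split.
- apply: (is_derive_congr (d := Re d + Re e)); last by case: (d) (e) => ? ? [].
  have -> : (fun y => Re (F y + G y)) = (fun y => Re (F y)) + (fun y => Re (G y)).
    by apply/funext => y; rewrite [RHS]/GRing.add /=; case: (F y) (G y) => ? ? [].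
  exact: is_deriveD.
- apply: (is_derive_congr (d := Im d + Im e)); last by case: (d) (e) => ? ? [].
  have -> : (fun y => Im (F y + G y)) = (fun y => Im (F y)) + (fun y => Im (G y)).
    by apply/funext => y; rewrite [RHS]/GRing.add /=; case: (F y) (G y) => ? ? [].
  exact: is_deriveD.
Qed.

Lemma is_cderiveM x F G d e : is_cderive x v F d -> is_cderive x v G e ->
  is_cderive x v (fun y => F y * G y) (d * G x + F x * e).
Proof.
move=> [F1 F2] [G1 G2]; split.
- apply: (is_derive_congr (d := (Re (F x) *: Re e + Re (G x) *: Re d)
    - (Im (F x) *: Im e + Im (G x) *: Im d))); last first.
    by case: (d) (e) (F x) (G x) => ? ? [? ?] [? ?] [? ?]; rewrite /= /GRing.scale /=; ring.
  have -> : (fun y => Re (F y * G y)) = (fun y => Re (F y)) * (fun y => Re (G y))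
      - (fun y => Im (F y)) * (fun y => Im (G y)).
    by apply/funext => y; rewrite -[RHS]/(_ * _ - _ * _); case: (F y) (G y) => ? ? [].
  by apply: is_deriveB; apply: is_deriveM.
- apply: (is_derive_congr (d := (Re (F x) *: Im e + Im (G x) *: Re d)
    + (Im (F x) *: Re e + Re (G x) *: Im d))); last first.
    by case: (d) (e) (F x) (G x) => ? ? [? ?] [? ?] [? ?]; rewrite /= /GRing.scale /=; ring.
  have -> : (fun y => Im (F y * G y)) = (fun y => Re (F y)) * (fun y => Im (G y))
      + (fun y => Im (F y)) * (fun y => Re (G y)).
    by apply/funext => y; rewrite -[RHS]/(_ * _ + _ * _); case: (F y) (G y) => ? ? [].
  by apply: is_deriveD; apply: is_deriveM.
Qed.

Lemma is_cderive_real x (f : W -> R) (d : R) : is_derive x v f d ->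
  is_cderive x v (fun y => (f y)%:C) (d%:C).
Proof. by move=> fd; split => //=; exact: is_derive_cst. Qed.

Lemma is_cderive_ext x F G d : F =1 G -> is_cderive x v F d ->
  is_cderive x v G d.
Proof. by move=> /funext ->. Qed.

End Rules.

(** Both difference quotients are the same function, so directional derivatives reduce to
    derivatives in one real variable. *)
Lemma is_derive_line (W : normedModType R) (x v : W) (f : W -> R) d :
  is_derive (0 : R) 1 (fun t => f (t *: v + x)) d -> is_derive x v f d.
Proof.
have E : (fun h => h^-1 *: (((fun t => f (t *: v + x)) \o shift 0) (h *: 1)
     - f (0 *: v + x))) =  (fun h : R => h^-1 *: ((f \o shift x) (h *: v) - f x)).
  by apply/funext => h; rewrite /= addr0 scale0r add0r /GRing.scale /= mulr1.
by case=> [e1 e2]; split; [rewrite /derivable -E | rewrite /derive -E].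
Qed.

Lemma is_derive_affine (a b t : R) :
  is_derive t (1 : R) (fun t : R => a * t + b) a.
Proof.
have H := is_deriveD (is_deriveZ a (is_derive_id t (1 : R)))
  (is_derive_cst b t 1).
by apply: (is_derive_congr H); rewrite addr0 /GRing.scale /= mulr1.
Qed.

Lemma is_derive_coord N (x v : 'cV[R]_N) i :
  is_derive x v (fun y : 'cV[R]_N => y i ord0) (v i ord0).
Proof.
apply: is_derive_line.
have -> : (fun t : R => (t *: v + x) i ord0) = (fun t => v i ord0 * t + x i ord0).
  by apply/funext => t; rewrite !mxE mulrC.
exact: is_derive_affine.
Qed.

Lemma is_cderive_pev N (p : mpoly N C) x v :
  is_cderive x v (pev p) (\sum_i (v i ord0)%:C * pev (mderiv i p) x).
Proof.
pose D p x := \sum_i (v i ord0)%:C * pev (mderiv i p) x.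
rewrite -/(D p x); elim/mpoly_ring_ind: p x => [c|i|p q Pp Pq|p q Pp Pq] x.
- rewrite (_ : D _ x = 0); last first.
    by rewrite /D big1 // => i _; rewrite mderivC pev0 mulr0.
  by apply: is_cderive_ext (is_cderive_cst _ _ c) => y; rewrite pevC.
- apply: (is_cderive_ext (F := fun y : 'cV[R]_N => (y i ord0)%:C)).
    by move=> y; rewrite pevX.
  apply: is_cderive_eq; first exact/is_cderive_real/is_derive_coord.
  rewrite /D (bigD1 i) //= big1 => [|l /negPf li].
    by rewrite mderivXX eqxx addr0 pev1 mulr1.
  by rewrite mderivXX eq_sym li pev0 mulr0.
- apply: (is_cderive_ext (F := fun y => pev p y + pev q y)).
    by move=> y; rewrite pevD.
  apply: is_cderive_eq; first exact: is_cderiveD (Pp x) (Pq x).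
  rewrite /D -big_split; apply: eq_bigr => i _ /=.
  by rewrite mderivD pevD mulrDr.
apply: (is_cderive_ext (F := fun y => pev p y * pev q y)).
  by move=> y; rewrite pevM.
apply: is_cderive_eq; first exact: is_cderiveM (Pp x) (Pq x).
rewrite /D mulr_suml mulr_sumr -big_split; apply: eq_bigr => i _ /=.
by rewrite mderivM pevD !pevM; ring.
Qed.

Lemma dderivP j (x v : V j) F d : is_cderive x v F d -> dderiv v F x = d.
Proof.
by case=> [/@derive_val + /@derive_val]; rewrite /dderiv => -> ->; case: d.
Qed.

(* [mderiv] conjugated by [exp (- tr)]. *)
Definition twd j (i : 'I_(1 + j.-1)) (p : mpoly (1 + j.-1) C) :=
  mderiv i p - ((i == ord0)%:R * 2) *: p.

Lemma dderiv_polexp j (x v : V j) (p : mpoly (1 + j.-1) C) :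
  dderiv v (polexp p) x = polexp (\sum_i (v i ord0)%:C *: twd i p) x.
Proof.
apply: dderivP; pose e (y : V j) : R := expR (- jtr y).
have De : is_derive x v e (e x * (- 2 * v ord0 ord0)).
  apply: is_derive_line.
  apply: (is_derive1_comp (f := expR) (g := fun t => - jtr (t *: v + x))).
    rewrite scale0r add0r; exact: is_derive_expR.
  have -> : (fun t => - jtr (t *: v + x)) =
     (fun t => (- 2 * v ord0 ord0) * t + - 2 * x ord0 ord0).
    apply/funext => t; rewrite /jtr /tcoord !mxE /=.
    have -> : lshift j.-1 ord0 = ord0 :> 'I_(1 + j.-1) by apply/val_inj.
    by ring.
  exact: is_derive_affine.
apply: (is_cderive_ext (F := fun y => pev p y * (e y)%:C)).
  by move=> y; rewrite polexpE.
apply: is_cderive_eq (is_cderiveM (is_cderive_pev p x v) (is_cderive_real De)) _.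
rewrite polexpE -/(e x) pev_sum.
under [in RHS]eq_bigr do rewrite pevZ /twd pevB pevZ mulrBr.
rewrite sumrB mulrBl; congr (_ + _).
rewrite (bigD1 ord0) //= big1 => [|i /negPf ->]; last by rewrite !mul0r mulr0.
rewrite mul1r addr0 !rmorphM /= rmorphN rmorph_nat.
ring.
Qed.

End Derivatives.

(** * The Bessel operator in coordinates *)

Section Bessel.
Variable R : realType.
Local Notation C := R[i].
Local Notation V := (@V R).

Lemma dotE q (x y : 'cV[R]_q) : dot x y = \sum_i x i ord0 * y i ord0.
Proof. by rewrite /dot mxE; apply: eq_bigr => i _; rewrite mxE. Qed.

Lemma dotC q (x y : 'cV[R]_q) : dot x y = dot y x.
Proof. by rewrite !dotE; apply: eq_bigr => i _; rewrite mulrC. Qed.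

Lemma dotDr q (x y z : 'cV[R]_q) : dot x (y + z) = dot x y + dot x z.
Proof. by rewrite /dot mulmxDr mxE. Qed.

Lemma dotZr q c (x y : 'cV[R]_q) : dot x (c *: y) = c * dot x y.
Proof. by rewrite /dot -scalemxAr mxE. Qed.

Lemma dotNr q (x y : 'cV[R]_q) : dot x (- y) = - dot x y.
Proof. by rewrite -scaleN1r dotZr mulN1r. Qed.

Lemma dotBr q (x y z : 'cV[R]_q) : dot x (y - z) = dot x y - dot x z.
Proof. by rewrite dotDr dotNr. Qed.

Lemma dotZl q c (x y : 'cV[R]_q) : dot (c *: x) y = c * dot x y.
Proof. by rewrite dotC dotZr dotC. Qed.

Lemma dot_split j (x y : V j) :
  dot x y = tcoord x * tcoord y + dot (scoord x) (scoord y).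
Proof.
rewrite !dotE big_split_ord /= big_ord1 /tcoord !mxE; congr (_ + _).
by apply: eq_bigr => i _; rewrite !mxE.
Qed.

(** The Lorentz form of signature (1, j-1), which polarises Delta. *)
Definition jdot j (x y : V j) : R :=
  tcoord x * tcoord y - dot (scoord x) (scoord y).

Lemma tcoord_jmul j (x y : V j) :
  tcoord (jmul x y) = tcoord x * tcoord y + dot (scoord x) (scoord y).
Proof. by rewrite /tcoord /jmul col_mxKu mxE eqxx mulr1n. Qed.

Lemma scoord_jmul j (x y : V j) :
  scoord (jmul x y) = tcoord x *: scoord y + tcoord y *: scoord x.
Proof. by rewrite /scoord /jmul col_mxKd. Qed.

(** In this Jordan algebra P(a,b)x = (a.x) b + (b.x) a - [jdot a b] Jx; the last term is the source
    of the wave operator. *)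
Lemma dot_Pop j (a b x v : V j) :
  dot v (Pop a b *m x) = dot a x * dot b v + dot b x * dot a v
                         - jdot a b * jdot v x.
Proof.
rewrite /Pop mulmxBl mulmxDl -!mulmxA !mulLE dotBr dotDr !dot_split /jdot.
rewrite !tcoord_jmul !scoord_jmul !dotDr !dotZr !tcoord_jmul.
rewrite [dot (_ + _) (scoord x)]dotC !dotDr !dotZr (dotC (scoord b) (scoord a)).
rewrite (dotC (scoord x) (scoord b)) (dotC (scoord x) (scoord a)).
rewrite (dotC (scoord v) (scoord a)) (dotC (scoord v) (scoord b)).
ring.
Qed.

Definition eps j (i : 'I_(1 + j.-1)) : R := if i == ord0 then 1 else - 1.

Lemma tcoordE j (x : V j) : tcoord x = x ord0 ord0.
Proof. by rewrite /tcoord mxE; congr (x _ _); apply/val_inj. Qed.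

Lemma scoordE j (x : V j) i : scoord x i ord0 = x (rshift 1 i) ord0.
Proof. by rewrite /scoord mxE. Qed.

Lemma jdotE j (x y : V j) :
  jdot x y = \sum_i eps i * (x i ord0 * y i ord0).
Proof.
rewrite big_split_ord /= big_ord1 /jdot !tcoordE dotE -sumrN.
have -> : lshift j.-1 ord0 = ord0 :> 'I_(1 + j.-1) by apply/val_inj.
rewrite /eps eqxx mul1r; congr (_ + _); apply: eq_bigr => i _.
by rewrite !scoordE mulN1r.
Qed.

Lemma dot_delta q i (x : 'cV[R]_q) : dot (delta_mx i ord0) x = x i ord0.
Proof.
rewrite dotE (bigD1 i) //= !mxE !eqxx mul1r big1 ?addr0 // => l /negPf li.
by rewrite mxE li mul0r.
Qed.

Lemma jdot_delta j (a b : 'I_(1 + j.-1)) :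
  jdot (delta_mx a ord0 : V j) (delta_mx b ord0) = (a == b)%:R * eps a.
Proof.
rewrite jdotE (bigD1 a) //= !mxE !eqxx mul1r big1 => [|l /negPf la].
  by rewrite addr0 andbT mulrC.
by rewrite mxE la !(mul0r, mulr0).
Qed.

Lemma jmulZl j c (x y : V j) : jmul (c *: x) y = c *: jmul x y.
Proof.
have tZ : tcoord (c *: x) = c * tcoord x by rewrite /tcoord linearZ mxE.
have sZ : scoord (c *: x) = c *: scoord x by rewrite /scoord linearZ.
rewrite /jmul tZ sZ dotZl scale_col_mx scale_scalar_mx; congr col_mx.
  by rewrite mulrDr mulrA.
by rewrite scalerDr !scalerA [_ * c]mulrC.
Qed.

Lemma PopZ j c (a b : V j) : Pop (c *: a) (c *: b) = c ^+ 2 *: Pop a b.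
Proof.
have LZ d (y : V j) : Lop (d *: y) = d *: Lop y.
  by apply/matrixP => i k; rewrite [LHS]mxE jmulZl [LHS]mxE [RHS]mxE [in RHS]mxE.
have jZ : jmul (c *: a) (c *: b) = c ^+ 2 *: jmul a b.
  by rewrite -!mulLE LZ -scalemxAl -scalemxAr scalerA.
rewrite /Pop jZ !LZ -!scalemxAl -!scalemxAr !scalerA -expr2.
by rewrite -scalerDr -scalerBr.
Qed.

Lemma jform_Pop_onb j (a b : 'I_(1 + j.-1)) (v x : V j) :
  jform v (Pop (onb a) (onb b : V j) *m x) =
  x a ord0 * v b ord0 + x b ord0 * v a ord0 - (a == b)%:R * eps a * jdot v x.
Proof.
rewrite jformE /onb PopZ -scalemxAl dotZr dot_Pop !dot_delta jdot_delta.
by rewrite exprVn sqr_sqrtr ?ler0n // mulrA divff ?mul1r // pnatr_eq0.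
Qed.

Lemma twd_is_linear j i : linear (@twd R j i).
Proof.
move=> c p q; rewrite /twd mderivD mderivZ !scalerDr !scalerN !scalerA.
by rewrite [_ * c]mulrC opprD addrACA.
Qed.
HB.instance Definition _ j i := GRing.isLinear.Build C _ _ _ (@twd R j i)
  (@twd_is_linear j i).

Lemma twdC j a b (p : mpoly (1 + j.-1) C) : twd a (twd b p) = twd b (twd a p).
Proof.
rewrite /twd !mderivB !mderivZ mderiv_comm !scalerBr !scalerA.
have subC (M : zmodType) (s t u v : M) : s - t - (u - v) = s - u - (t - v).
  by rewrite !opprB addrACA [in RHS]addrACA [- t + _]addrC.
rewrite [(b == ord0)%:R * 2 * _]mulrC; exact: subC.
Qed.

Lemma twdM j a (p q : mpoly (1 + j.-1) C) :
  twd a (p * q) = twd a p * q + p * mderiv a q.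
Proof. by rewrite /twd mderivM mulrBl -scalerAl addrAC. Qed.

Lemma dderiv_onb j (b : 'I_(1 + j.-1)) (p : mpoly (1 + j.-1) C) :
  dderiv (onb b : V j) (polexp p) = polexp (((Num.sqrt 2)^-1)%:C *: twd b p).
Proof.
apply/funext => x; rewrite dderiv_polexp; congr polexp.
rewrite (bigD1 b) //= !mxE !eqxx mulr1 big1 ?addr0 // => i /negPf ib.
by rewrite !mxE ib mulr0 scale0r.
Qed.

(** The two directions [onb a] and [onb b] contribute 1/sqrt 2 each. In the first sum the resulting
    1/2 is absorbed by the symmetry of second derivatives, which identifies the two halves of the
    coefficient; in front of the wave operator it survives. In the first-order term it cancels the 2
    of the trace form. *)
Lemma besselE j (lambda : R) (v : V j) (p : mpoly (1 + j.-1) C) x :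
  bessel lambda v (polexp p) x =
  ((\sum_a \sum_b (x a ord0 * v b ord0)%:C * pev (twd a (twd b p)) x)
  - (jdot v x / 2)%:C * (\sum_a (eps a)%:C * pev (twd a (twd a p)) x)
  + lambda%:C * (\sum_a (v a ord0)%:C * pev (twd a p) x))
  * (expR (- jtr x))%:C.
Proof.
have s2 : (Num.sqrt 2)^-1 * (Num.sqrt 2)^-1 = 2^-1 :> R.
  by rewrite -invfM -expr2 sqr_sqrtr.
set e := (expR _)%:C; pose T a b := pev (twd a (twd b p)) x.
rewrite /bessel mulrDl; congr (_ + _); last first.
  rewrite -mulrA; congr (_ * _); rewrite mulr_suml; apply: eq_bigr => a _.
  rewrite dderiv_onb polexpE pevZ -/e !mulrA -rmorphM; congr (_%:C * _ * _).
  rewrite jformE /onb dotZr dotC dot_delta mulrCA -mulrA mulrC -!mulrA s2.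
  by rewrite mulrCA divff ?mulr1 // pnatr_eq0.
transitivity (\sum_a \sum_b ((x a ord0 * v b ord0)%:C * (T a b / 2)
   + (v a ord0 * x b ord0)%:C * (T a b / 2)
   - (if a == b then (jdot v x / 2)%:C * ((eps a)%:C * T a a) else 0)) * e).
  apply: eq_bigr => a _; apply: eq_bigr => b _.
  rewrite !dderiv_onb polexpE -/e linearZ /= !pevZ -/(T a b) jform_Pop_onb.
  rewrite !mulrA; congr (_ * e); rewrite -[_ * _%:C]mulrA -[_ * _%:C * _]mulrA.
  rewrite -[_%:C * _%:C]rmorphM /= s2 rmorphV ?unitfE ?pnatr_eq0 // rmorph_nat.
  case: eqP => [<-|_]; rewrite ?mul1r ?mul0r ?subr0.
    by rewrite !(rmorphB, rmorphD, rmorphM) /= rmorphV ?unitfE ?pnatr_eq0 // rmorph_nat; ring.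
  by rewrite !(rmorphD, rmorphM) /=; ring.
under eq_bigr do rewrite -mulr_suml sumrB big_split.
rewrite -mulr_suml sumrB big_split /=; congr (_ * e); congr (_ - _).
  rewrite [X in _ + X]exchange_big -big_split; apply: eq_bigr => a _ /=.
  rewrite -big_split; apply: eq_bigr => b _ /=.
  by rewrite /T [twd b (twd a p)]twdC [v b _ * _]mulrC -mulrDr -splitr.
rewrite mulr_sumr; apply: eq_bigr => a _.
by rewrite -big_mkcond /= (eq_bigl (pred1 a)) ?big_pred1_eq // => b; rewrite /= eq_sym.
Qed.

End Bessel.

(** * The action as an operator on polynomials *)

Section Action.
Variable R : realType.
Local Notation C := R[i].
Local Notation V := (@V R).
Local Notation triple := (@triple R).
Local Notation X := (fun l => mpolyX C (mnm1 l)).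

(** The operator [dpi_fun] with the factor exp(-tr) removed: each derivative becomes a [twd], and
    (u|x) is written as 2 u.x. *)
Definition dpoly_def j (lambda : R) (Z : triple j) (p : mpoly (1 + j.-1) C) :
    mpoly (1 + j.-1) C :=
  let: (u, T, v) := Z in
  'i *: (\sum_a (2 * u a ord0)%:C *: X a) * p
  + (\sum_a (\sum_b (adj T a b)%:C *: X b) * twd a p
     + (lambda / j%:R * \tr (adj T))%:C *: p)
  + 'i *: (\sum_a \sum_b (v b ord0)%:C *: (X a * twd a (twd b p))
     - (\sum_a (eps R a * v a ord0 / 2)%:C *: X a)
       * (\sum_a (eps R a)%:C *: twd a (twd a p))
     + lambda%:C *: \sum_a (v a ord0)%:C *: twd a p).

Fact dpoly_key : unit. Proof. exact: tt. Qed.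
Definition dpoly := locked_with dpoly_key dpoly_def.

(* The action at the point [x], as a function of the 2-jet of the polynomial. *)
Definition opval j (lambda : R) (Z : triple j) (x : V j) (P : C)
    (P1 : 'I_(1 + j.-1) -> C) (P2 : 'I_(1 + j.-1) -> 'I_(1 + j.-1) -> C) : C :=
  let: (u, T, v) := Z in
  'i * (2 * dot u x)%:C * P
  + (\sum_a ((adj T *m x) a ord0)%:C * P1 a + (lambda / j%:R * \tr (adj T))%:C * P)
  + 'i * (\sum_a \sum_b (x a ord0 * v b ord0)%:C * P2 a b
          - (jdot v x / 2)%:C * (\sum_a (eps R a)%:C * P2 a a)
          + lambda%:C * (\sum_a (v a ord0)%:C * P1 a)).

Lemma pev_dpoly j (lambda : R) (Z : triple j) p x :
  pev (dpoly lambda Z p) x = opval lambda Z x (pev p x)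
    (fun a => pev (twd a p) x) (fun a b => pev (twd a (twd b p)) x).
Proof.
case: Z => [[u T] v]; rewrite /dpoly unlock /=.
rewrite !(pevD, pevN, pevM, pevZ, pev_sum); congr (_ + (_ + _) + 'i * (_ - _ + _)).
- congr ('i * _ * _); rewrite dotE mulr_sumr rmorph_sum; apply: eq_bigr => a _ /=.
  by rewrite pevZ pevX -rmorphM mulrA.
- apply: eq_bigr => a _; rewrite pevM pev_sum; congr (_ * _).
  rewrite mxE rmorph_sum; apply: eq_bigr => b _ /=.
  by rewrite pevZ pevX -rmorphM.
- apply: eq_bigr => a _; rewrite pev_sum; apply: eq_bigr => b _.
  by rewrite pevZ pevM pevX rmorphM /=; ring.
- congr (_ * _); last by apply: eq_bigr => a _; rewrite pevZ.
  rewrite jdotE mulr_suml rmorph_sum; apply: eq_bigr => a _ /=.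
  by rewrite pevZ pevX -rmorphM; congr (_%:C); ring.
by congr (_ * _); apply: eq_bigr => a _; rewrite pevZ.
Qed.

Lemma dpi_polexp j (lambda : R) (Z : triple j) p x :
  dpi_fun lambda Z (polexp p) x = polexp (dpoly lambda Z p) x.
Proof.
rewrite [RHS]polexpE pev_dpoly; case: Z => [[u T] v].
rewrite /dpi_fun /opval besselE dderiv_polexp !polexpE jformE.
rewrite pev_sum; under [X in _ + (X * _ + _) + _ = _]eq_bigr do rewrite pevZ.
by ring.
Qed.

Definition qform j : mpoly (1 + j.-1) C := \sum_a (eps R a)%:C *: (X a * X a).

Lemma pev_qform j (x : V j) : pev (qform j) x = (jdot x x)%:C.
Proof.
rewrite pev_sum jdotE rmorph_sum; apply: eq_bigr => a _ /=.
by rewrite pevZ pevM !pevX !rmorphM.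
Qed.

Lemma mderiv_qform j (a : 'I_(1 + j.-1)) :
  mderiv a (qform j) = (2 * eps R a)%:C *: X a.
Proof.
rewrite /qform raddf_sum (bigD1 a) //= big1 => [|b /negPf ba].
  rewrite mderivZ mderivM mderivXX eqxx mulr1 mul1r addr0 -mulr2n -scaler_nat.
  by rewrite scalerA rmorphM rmorph_nat mulrC.
by rewrite mderivZ mderivM mderivXX ba mulr0 mul0r addr0 scaler0.
Qed.

Definition Jv j (x : V j) : V j := col_mx (usubmx x) (- dsubmx x).

Lemma tcoord_Jv j (x : V j) : tcoord (Jv x) = tcoord x.
Proof. by rewrite /tcoord /Jv col_mxKu. Qed.

Lemma scoord_Jv j (x : V j) : scoord (Jv x) = - scoord x.
Proof. by rewrite /scoord /Jv col_mxKd. Qed.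

Lemma jdot_Jv j (x y : V j) : jdot x y = dot x (Jv y).
Proof.
rewrite dot_split /jdot tcoord_Jv scoord_Jv.
by rewrite dotNr.
Qed.

Lemma dot_adj j (T : 'M[R]_(1 + j.-1)) (x y : V j) :
  dot (adj T *m x) y = dot x (T *m y).
Proof. by rewrite /dot /adj trmx_mul trmxK mulmxA. Qed.

Lemma dot_so q (D : 'M[R]_q) x : so D -> dot x (D *m x) = 0.
Proof.
move=> soD; suff : dot x (D *m x) = - dot x (D *m x).
  by move/eqP; rewrite -addr_eq0 -mulr2n mulrn_eq0 /= => /eqP.
have {2}-> : dot x (D *m x) = dot (D^T *m x) x.
  by rewrite /dot trmx_mul trmxK mulmxA.
have DN : D^T = - D := soD.
by rewrite DN mulNmx [in RHS]dotC dotNr opprK.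
Qed.

(** Infinitesimal invariance of the light cone: the rotation part contributes 0 by skew symmetry,
    and L(a) contributes a_1 Delta(x). *)
Lemma jdot_str j (T : 'M[R]_(1 + j.-1)) (x : V j) :
  str_alg T -> jdot x x = 0 -> jdot (adj T *m x) x = 0.
Proof.
case=> a [D [soD ->]] x0; rewrite jdot_Jv dot_adj mulmxDl dotDr mulLE.
have -> : dot x (ext_so D *m Jv x) = 0.
  rewrite /ext_so /Jv mul_block_col !mul0mx !addr0 add0r dot_split.
  rewrite /tcoord /scoord col_mxKu col_mxKd [X in _ * X + _]mxE mulr0 add0r.
  by rewrite mulmxN dotNr dot_so // oppr0.
rewrite dot_split tcoord_jmul scoord_jmul tcoord_Jv scoord_Jv.
move: x0; rewrite /jdot dotDr !dotZr !dotNr (dotC (scoord x) (scoord a)).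
by move/eqP; rewrite subr_eq0 => /eqP <-; ring.
Qed.

Lemma eps2 j (a : 'I_(1 + j.-1)) : eps R a * eps R a = 1.
Proof. by rewrite /eps; case: eqP => _; ring. Qed.

(** At a point of the cone the terms with derivatives of q cancel: the wave operator produces four
    times the Euler term, which its factor 1/2 matches against the mixed second-order terms. The
    terms with q itself add up to (2 - n + 2 lambda) (v.Jx) q, which is where lambda = (n-2)/2 comes
    from. *)
Lemma dpoly_light n (Z : triple n) (q : mpoly (1 + n.-1) C) (x : V n) :
  (0 < n)%N -> so2 Z -> jdot x x = 0 ->
  pev (dpoly ((n%:R - 2) / 2) Z (q * qform n)) x = 0.
Proof.
move=> n0 ZP x0.
have xx : \sum_a (eps R a)%:C * ((x a ord0)%:C * (x a ord0)%:C) = 0.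
  transitivity ((jdot x x)%:C); last by rewrite x0.
  by rewrite jdotE rmorph_sum; apply: eq_bigr => a _; rewrite /= !rmorphM /=.
rewrite pev_dpoly; pose Q := pev q x; pose Q1 a := pev (twd a q) x.
have -> : pev (q * qform n) x = 0 by rewrite pevM pev_qform x0 mulr0.
have pev2 (A B D F p r s : mpoly (1 + n.-1) C) c d :
    pev (A * F + B * (c *: p) + (D * (d *: r) + q * (d *: s))) x =
    pev A x * pev F x + pev B x * (c * pev p x)
    + (pev D x * (d * pev r x) + pev q x * (d * pev s x)).
  by rewrite 3!pevD 4!pevM 3!pevZ.
(* The 2-jet of q Delta at a point where Delta vanishes and has gradient 2 Jx. *)
transitivity (opval ((n%:R - 2) / 2) Z x 0
  (fun a => 2 * Q * ((eps R a)%:C * (x a ord0)%:C))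
  (fun a b => 2 * ((eps R a)%:C * (x a ord0)%:C) * Q1 b
  + 2 * ((eps R b)%:C * (x b ord0)%:C) * Q1 a + (a == b)%:R * (2 * Q * (eps R a)%:C))).
  congr opval; apply/funext => a.
    rewrite twdM mderiv_qform pevD !pevM pevZ pevX pev_qform x0.
    by rewrite mulr0 add0r rmorphM /= rmorph_nat -/Q; ring.
  apply/funext => b.
  rewrite twdM linearD /= !twdM !mderiv_qform mderivZ mderivXX.
  rewrite /Q1; move: (twd a q) (twd b q) (twd a (twd b q)) => ? ? ?.
  etransitivity; first exact: pev2.
  rewrite pev_qform x0 mulr0 add0r 2!pevX -/Q.
  have -> : pev ((b == a)%:R) x = (a == b)%:R :> C.
    by rewrite eq_sym; case: eqP => _; rewrite ?pev1 ?pev0.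
  rewrite !rmorphM /= rmorph_nat.
  by case: (a =P b) => [<-|_]; rewrite /= ?mulr1n ?mulr0n; ring.
clearbody Q Q1; case: Z ZP => [[u T] v] /= ZP.
have TT : \sum_a ((adj T *m x) a ord0)%:C * (2 * Q * ((eps R a)%:C * (x a ord0)%:C)) = 0.
  transitivity (2 * Q * (jdot (adj T *m x) x)%:C); last by rewrite jdot_str ?mulr0.
  rewrite jdotE rmorph_sum mulr_sumr; apply: eq_bigr => a _ /=.
  by rewrite !rmorphM /=; ring.
rewrite TT !mulr0 !add0r.
pose vx := \sum_a (v a ord0)%:C * ((eps R a)%:C * (x a ord0)%:C).
have vxE : (jdot v x)%:C = vx.
  rewrite jdotE rmorph_sum; apply: eq_bigr => a _ /=.
  by rewrite !rmorphM /=; ring.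
pose EQ := \sum_a (x a ord0)%:C * Q1 a.
have -> : \sum_a \sum_b (x a ord0 * v b ord0)%:C *
    (2 * ((eps R a)%:C * (x a ord0)%:C) * Q1 b +
     2 * ((eps R b)%:C * (x b ord0)%:C) * Q1 a +
     (a == b)%:R * (2 * Q * (eps R a)%:C)) = 2 * EQ * vx + 2 * Q * vx.
  transitivity (\sum_a (2 * ((eps R a)%:C * ((x a ord0)%:C * (x a ord0)%:C)) * (\sum_b (v b ord0)%:C * Q1 b)
     + 2 * ((x a ord0)%:C * Q1 a) * vx + 2 * Q * ((v a ord0)%:C * ((eps R a)%:C * (x a ord0)%:C)))).
    apply: eq_bigr => a _; under eq_bigr do rewrite !mulrDr.
    rewrite !big_split; congr (_ + _ + _).
    - rewrite mulr_sumr; apply: eq_bigr => b _; rewrite !rmorphM /=; ring.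
    - rewrite /vx mulr_sumr; apply: eq_bigr => b _; rewrite !rmorphM /=; ring.
    rewrite (bigD1 a) //= big1 => [|b /negPf]; last by rewrite eq_sym => ->; rewrite mul0r mulr0.
    by rewrite eqxx rmorphM /=; ring.
  rewrite !big_split /= -!mulr_suml -!mulr_sumr xx -/vx -/EQ.
  by ring.
have -> : \sum_a (eps R a)%:C * (2 * ((eps R a)%:C * (x a ord0)%:C) * Q1 a +
     2 * ((eps R a)%:C * (x a ord0)%:C) * Q1 a + (a == a)%:R * (2 * Q * (eps R a)%:C))
   = 4 * EQ + n%:R * 2 * Q.
  transitivity (\sum_a (4 * ((x a ord0)%:C * Q1 a)) + \sum_(a : 'I_(1 + n.-1)) 2 * Q).
    rewrite -big_split; apply: eq_bigr => a _ /=; rewrite eqxx.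
    have e2 : (eps R a)%:C * (eps R a)%:C = 1 by rewrite -rmorphM eps2.
    transitivity ((eps R a)%:C * (eps R a)%:C * (4 * ((x a ord0)%:C * Q1 a) + 2 * Q)); last by rewrite e2 mul1r.
    by rewrite mulr1n; ring.
  have nE : (1 + n.-1 = n)%N by rewrite add1n prednK.
  have -> : \sum_(a : 'I_(1 + n.-1)) 2 * Q = n%:R * (2 * Q).
    by rewrite sumr_const card_ord nE -[LHS]mulr_natl.
  by rewrite -mulr_sumr -/EQ; ring.
have -> : \sum_a (v a ord0)%:C * (2 * Q * ((eps R a)%:C * (x a ord0)%:C)) = 2 * Q * vx.
  by rewrite /vx mulr_sumr; apply: eq_bigr => a _; ring.
have -> : (jdot v x / 2)%:C = vx / 2.
  by rewrite -vxE rmorphM /= rmorphV ?unitfE ?pnatr_eq0 // rmorph_nat.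
have -> : ((n%:R - 2) / 2 : R)%:C = (n%:R - 2) / 2.
  by rewrite rmorphM rmorphB /= rmorphV ?unitfE ?pnatr_eq0 // !rmorph_nat.
by field.
Qed.

End Action.

(** * Polynomials vanishing on cones and spheres *)

Section Density.
Variable R : realType.
Local Notation C := R[i].
Local Notation V := (@V R).

(** Induction on a bound for the degree: the partial derivatives vanish on U as well, hence are
    zero, so p is a constant, and its value at x0 is 0. *)
Lemma pev_open_eq0 q (U : set 'cV[R]_q) (x0 : 'cV[R]_q) (p : mpoly q C) :
  open U -> U x0 -> (forall x, U x -> pev p x = 0) -> p = 0.
Proof.
move=> Uo Ux0 pU.
have [d] : exists d, forall mo, mo \in msupp p -> (mdeg mo < d)%N.
  by exists (msize p) => mo; exact: msize_mdeg_lt.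
elim: d p pU => [|d IH] p pU pd.
  by rewrite (mpolyE p) big_seq big1 // => mo /pd.
have dp i : mderiv i p = 0.
  apply: IH => [x Ux|mo]; last first.
    rewrite mcoeff_msupp mcoeff_mderiv => mop.
    have /pd : mnm_add mo (mnm1 i) \in msupp p.
      by rewrite mcoeff_msupp; apply: contra_neq mop => ->; rewrite mul0rn.
    by rewrite mdegD mdeg1 addn1.
  have near0 : \near x, pev p x = 0.
    by apply: filterS (open_nbhs_nbhs (conj Uo Ux)) => y /pU.
  have [D1 D2] := is_cderive_pev p x (delta_mx i ord0).
  move: D1 D2; rewrite (bigD1 i) //= big1 => [|l /negPf li]; last first.
    by rewrite mxE li mul0r.
  rewrite mxE !eqxx mul1r addr0.
  have E1 : 'D_(delta_mx i ord0) (fun y => complex.Re (pev p y)) x = 0.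
    rewrite -(derive_cst (0 : R) x (delta_mx i ord0)).
    by apply: near_eq_derive; apply: filterS near0 => y ->.
  have E2 : 'D_(delta_mx i ord0) (fun y => complex.Im (pev p y)) x = 0.
    rewrite -(derive_cst (0 : R) x (delta_mx i ord0)).
    by apply: near_eq_derive; apply: filterS near0 => y ->.
  move=> /@derive_val; rewrite E1 => F1 /@derive_val; rewrite E2 => F2.
  by rewrite [LHS]complexE -F1 -F2 mulr0 addr0.
have pc : p = mpolyC q (mcoeff (@mnm0 q) p).
  apply/mpolyP => mo; rewrite mcoeffC.
  case: eqVneq => [->|mo0]; first by rewrite mulr1.
  have [i moi] : exists i, (mo i != 0)%N.
    apply/existsP; rewrite -negb_forall; apply: contra mo0 => /forallP mo0.
    by apply/eqP/mnmP => i; rewrite mnm0E; apply/eqP.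
  have := congr1 (mcoeff (mnm_sub mo (mnm1 i))) (dp i).
  rewrite mcoeff_mderiv mcoeff0 submK ?lep1mP // => /eqP.
  by rewrite mulrn_eq0 /= mulr0 => /eqP.
have := pU _ Ux0; rewrite pc pevC => ->; exact: mpolyC0.
Qed.

Lemma pev_eq0 q (p : mpoly q C) : (forall x, pev p x = 0) -> p = 0.
Proof. by move=> pE; apply: (@pev_open_eq0 _ setT 0) => //; exact: openT. Qed.

Definition open_cone j : set (V j) := [set x | 0 < tcoord x /\ 0 < jdot x x].

(** Polynomial inequalities replace the square root, so that openness of the cone is a matter of
    continuity. *)
Lemma open_coneP j (x : V j) :
  Num.sqrt (dot (scoord x) (scoord x)) < tcoord x <-> open_cone x.
Proof.
rewrite /open_cone /= /jdot subr_gt0 -expr2; set d := dot _ _.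
have d0 : 0 <= d.
  by rewrite /d dotE; apply: sumr_ge0 => i _; rewrite -expr2 sqr_ge0.
split=> [dx|[x0 dx]].
  have x0 : 0 < tcoord x by apply: le_lt_trans dx; rewrite sqrtr_ge0.
  by split=> //; rewrite -(sqr_sqrtr d0) ltr_pXn2r // nnegrE ?sqrtr_ge0 // ltW.
by rewrite -(ger0_norm (ltW x0)) -sqrtr_sqr ltr_sqrt // exprn_gt0.
Qed.

Lemma open_cone_open j : open (@open_cone j).
Proof.
have cc i : continuous (fun x : V j => x i ord0) by exact: coord_continuous.
have jc : continuous (fun x : V j => jdot x x).
  rewrite (_ : (fun x => _) = fun x : V j => \sum_i eps R i * (x i ord0 * x i ord0)).
    apply: continuous_big => [|i _ x]; first exact: add_continuous.
    exact: (cvgM (cvg_cst (eps R i)) (cvgM (cc i x) (cc i x))).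
  by apply/funext => x; rewrite jdotE.
have -> : @open_cone j = ([set x : V j | 0 < x ord0 ord0] `&` [set x : V j | 0 < jdot x x])%classic.
  by apply/seteqP; split => x; rewrite /open_cone /= tcoordE.
apply: openI.
  apply: (open_comp (f := fun x : V j => x ord0 ord0)
    (D := [set t : R | 0 < t])%classic) => [x _|]; [exact: cc|exact: open_gt].
apply: (open_comp (f := fun x : V j => jdot x x)
  (D := [set t : R | 0 < t])%classic) => [x _|]; [exact: jc|exact: open_gt].
Qed.

Lemma open_cone_jone j : open_cone (jone j : V j).
Proof.
by rewrite /open_cone /jdot /jone /dot /tcoord /scoord /= col_mxKu col_mxKd mulmx0 !mxE eqxx mulr1 subr0.
Qed.

Lemma pev_open_cone_eq0 j (p : mpoly (1 + j.-1) C) :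
  (forall x : V j, open_cone x -> pev p x = 0) -> p = 0.
Proof. exact: pev_open_eq0 (@open_cone_open j) (@open_cone_jone j). Qed.

End Density.

(** * Independence of harmonic polynomials on a sphere *)

Section Sphere.
Variable R : realType.
Local Notation C := R[i].

Lemma pev_homogZ q d (h : mpoly q C) (s : R) (w : 'cV[R]_q) :
  h \is ishomog1 d mdeg -> pev h (s *: w) = (s ^+ d)%:C * pev h w.
Proof.
move: h; apply: homog_ind => [|g h gE hE|c g gE|mo <-].
- by rewrite !pev0 mulr0.
- by rewrite !pevD gE hE mulrDr.
- by rewrite !pevZ gE mulrCA.
rewrite !pevE !mevalX mdegE rmorphXn -prodrXr -big_split; apply: eq_bigr => i _ /=.
by rewrite mxE rmorphM exprMn.
Qed.

Lemma pev_rsq q (z : 'cV[R]_q) : pev (rsq R q) z = (dot z z)%:C.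
Proof.
rewrite /rsq pev_sum dotE rmorph_sum; apply: eq_bigr => i _ /=.
by rewrite pevM pevX rmorphM.
Qed.

(* Split by parity, make the sum homogeneous with powers of [|z|^2], and read off
   that the top term is a multiple of [|z|^2]. *)
Lemma harm_sphere1 q N (h : nat -> mpoly q C) : (0 < q)%N ->
  (forall k, (k < N)%N -> h k \in @harm_pred R q k) ->
  (forall z, dot z z = 1 -> \sum_(k < N) pev (h k) z = 0) ->
  forall k, (k < N)%N -> h k = 0.
Proof.
move=> q0; elim: N => // K IH hh hS.
suff hK : h K = 0.
  move=> k; rewrite ltnS leq_eqVlt => /predU1P[->//|]; apply: IH => [l lK|z z1].
    by apply: hh; rewrite ltnS ltnW.
  by have := hS z z1; rewrite big_ord_recr /= hK pev0 addr0.
have hd k : (k <= K)%N -> h k \is ishomog1 k mdeg by move=> /hh /andP[].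
(* For k < K of the same parity K - k is at least 2, so one of the (K - k)/2 powers of |z|^2 can be
   split off. *)
pose G := \sum_(k < K | odd k == odd K) rsq R q ^+ ((K - k)./2).-1 * h k.
have Gd : G \is ishomog1 K.-2 mdeg.
  apply: rpred_sum => k /eqP kK.
  have -> : K.-2 = (2 * ((K - k)./2).-1 + k)%N by have := ltn_ord k; lia.
  by apply: dhomogM; rewrite ?hd ?(ltnW (ltn_ord _)) // dhomogMn // rsq_dhomog.
have hG : h K + rsq R q * G = 0.
  (* The extra factor |z|^2 disposes of z = 0, where no rescaling to the unit sphere exists. *)
  have : rsq R q * (h K + rsq R q * G) = 0.
    apply: pev_eq0 => z; rewrite pevM pev_rsq.
    have [->|z0] := eqVneq (dot z z) 0; first by rewrite mul0r.
    have zz : 0 < dot z z.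
      by rewrite lt0r z0 dotE sumr_ge0 // => i _; rewrite -expr2 sqr_ge0.
    apply/eqP; rewrite mulf_eq0; apply/orP; right.
    pose s := Num.sqrt (dot z z); pose w := s^-1 *: z.
    have s0 : 0 < s by rewrite sqrtr_gt0.
    have w1 : dot w w = 1.
      rewrite /w dotZl dotZr mulrA -invfM -expr2 sqr_sqrtr ?(ltW zz) //.
      by rewrite mulVf.
    have zE : z = s *: w by rewrite /w scalerA divff ?scale1r // gt_eqF.
    clearbody w; have S1 := hS _ w1.
    have w1' : dot (-1 *: w) (-1 *: w) = 1 by rewrite dotZl dotZr mulrA mulrNN !mul1r.
    have S2 := hS _ w1'.
    (* Combining the relations at w and -w with the sign (-1)^K kills the terms of the other parity
       and doubles the rest. *)
    have odds : \sum_(k < K.+1 | odd k == odd K) pev (h k) w = 0.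
      have : \sum_(k < K.+1) (pev (h k) w + (-1) ^+ K * pev (h k) (-1 *: w)) = 0.
        by rewrite big_split /= -mulr_sumr S1 S2 mulr0 addr0.
      rewrite (bigID (fun k : 'I_K.+1 => odd k == odd K)) /=.
      rewrite [X in _ + X]big1 => [|k kK]; last first.
        rewrite (pev_homogZ _ _ (hd _ (ltn_ord k))) mulrA rmorphXn rmorphN1 -exprD.
        rewrite -signr_odd oddD; move: kK; case: (odd k); case: (odd K) => //= _;
        by rewrite mulN1r addrN.
      rewrite addr0 (eq_bigr (fun k : 'I_K.+1 => 2 * pev (h k) w)) => [|k kK]; last first.
        rewrite (pev_homogZ _ _ (hd _ (ltn_ord k))) mulrA rmorphXn rmorphN1 -exprD.
        rewrite -signr_odd oddD (eqP kK) addbb mul1r; ring.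
      by rewrite -mulr_sumr => /eqP; rewrite mulf_eq0 pnatr_eq0 => /eqP.
    have hz k : (k <= K)%N -> pev (h k) z = (s ^+ k)%:C * pev (h k) w.
      by move=> kK; rewrite zE; apply: pev_homogZ; apply: hd.
    apply/eqP; transitivity ((s ^+ K)%:C * \sum_(k < K.+1 | odd k == odd K) pev (h k) w).
      rewrite big_mkcond big_ord_recr /= -big_mkcond eqxx mulrDr pevD pevM pev_rsq.
      rewrite pev_sum hz // addrC; congr (_ + _).
      rewrite [LHS]mulr_sumr [RHS]mulr_sumr; apply: eq_bigr => k /eqP kK.
      rewrite pevM hz ?(ltnW (ltn_ord k)) //.
      have -> : pev (rsq R q ^+ ((K - k)./2).-1) z = ((dot z z) ^+ ((K - k)./2).-1)%:C.
        by rewrite pevXn pev_rsq rmorphXn.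
      rewrite !mulrA -!rmorphM /= -exprS.
      have -> : dot z z = s ^+ 2 by rewrite sqr_sqrtr // ltW.
      rewrite -exprM -exprD; congr ((s ^+ _)%:C * _).
      by have := ltn_ord k; lia.
    by rewrite odds mulr0.
  by move/eqP; rewrite mulf_eq0 (negPf (rsq_neq0 R q0)) => /eqP.
(* As h K is harmonic, [hG] makes |z|^2 G harmonic too. *)
have G0 : G = 0.
  apply: (lap_rsq_inj q0 Gd).
  have := congr1 (@laplacian R q) hG; rewrite lapD lap0.
  by have /andP[_ /eqP ->] := hh K (ltnSn K); rewrite add0r.
by move: hG; rewrite G0 mulr0 addr0.
Qed.

Lemma harm_sphere q N (h : nat -> mpoly q C) (c : R) : (0 < q)%N -> 0 < c ->
  (forall k, (k < N)%N -> h k \in @harm_pred R q k) ->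
  (forall z, dot z z = c -> \sum_(k < N) pev (h k) z = 0) ->
  forall k, (k < N)%N -> h k = 0.
Proof.
move=> q0 c0 hh hS k kN.
have s0 : Num.sqrt c != 0 by rewrite gt_eqF // sqrtr_gt0.
suff /eqP : (Num.sqrt c ^+ k)%:C *: h k = 0.
  rewrite scaler_eq0 => /orP[|/eqP//].
  by rewrite (fmorph_eq0 (real_complex R)) expf_eq0 (negPf s0) andbF.
apply: (harm_sphere1 (h := fun k => (Num.sqrt c ^+ k)%:C *: h k) q0 _ _ kN).
  by move=> l /hh lh; rewrite rpredZ.
move=> z z1; rewrite -[RHS](hS (Num.sqrt c *: z)).
  apply: eq_bigr => l _; have /andP[lh _] := hh l (ltn_ord l).
  by rewrite pevZ (pev_homogZ _ _ lh).
by rewrite dotZl dotZr z1 mulr1 -expr2 sqr_sqrtr // ltW.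
Qed.

End Sphere.

(** * Restriction to so(2,m) + so(n-m) *)

Section Rename.
Variable R : realType.
Local Notation C := R[i].
Local Notation X := (fun l => mpolyX C (mnm1 l)).

Fact ren_key : unit. Proof. exact: tt. Qed.
Definition ren a b (f : 'I_a -> 'I_b) : mpoly a C -> mpoly b C :=
  locked_with ren_key (comp_mpoly [tuple X (f i) | i < a]).

Lemma renE a b (f : 'I_a -> 'I_b) p :
  ren f p = comp_mpoly [tuple X (f i) | i < a] p.
Proof. by rewrite /ren unlock. Qed.

Lemma pev_ren a b (f : 'I_a -> 'I_b) p (x : 'cV[R]_b) :
  pev (ren f p) x = pev p (\col_i x (f i) ord0).
Proof.
rewrite renE !pevE comp_mpoly_meval; apply: meval_eq => i.
by rewrite tnth_mktuple mevalXU mxE.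
Qed.

Lemma renX a b (f : 'I_a -> 'I_b) i : ren f (X i) = X (f i).
Proof. by rewrite renE comp_mpolyXU -tnth_nth tnth_mktuple. Qed.

Lemma ren_is_linear a b (f : 'I_a -> 'I_b) : linear (ren f).
Proof. by move=> c p q; rewrite !renE linearP. Qed.
HB.instance Definition _ a b f :=
  GRing.isLinear.Build C _ _ _ (@ren a b f) (@ren_is_linear a b f).

Lemma renM a b (f : 'I_a -> 'I_b) p q : ren f (p * q) = ren f p * ren f q.
Proof. by rewrite !renE rmorphM. Qed.

Lemma mderiv_ren a b (f : 'I_a -> 'I_b) l p :
  mderiv l (ren f p) = \sum_i (f i == l)%:R * ren f (mderiv i p).
Proof.
elim/mpoly_ring_ind: p => [c|i|p q pE qE|p q pE qE].
- rewrite renE comp_mpolyC mderivC big1 // => i _.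
  by rewrite mderivC raddf0 mulr0.
- rewrite renX mderivXX (bigD1 i) //= mderivXX eqxx big1 => [|k /negPf ki].
    by rewrite renE comp_mpoly1 mulr1 addr0.
  by rewrite mderivXX [i == k]eq_sym ki raddf0 mulr0.
- rewrite raddfD mderivD pE qE -big_split; apply: eq_bigr => i _ /=.
  by rewrite mderivD raddfD mulrDr.
rewrite renM mderivM pE qE mulr_suml mulr_sumr -big_split.
by apply: eq_bigr => i _ /=; rewrite mderivM raddfD /= !renM; ring.
Qed.

Lemma mderiv_ren_inj a b (f : 'I_a -> 'I_b) i p : injective f ->
  mderiv (f i) (ren f p) = ren f (mderiv i p).
Proof.
move=> f_inj; rewrite mderiv_ren (bigD1 i) //= eqxx mul1r big1 ?addr0 // => k ki.
by rewrite (inj_eq f_inj) (negPf ki) mul0r.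
Qed.

Lemma mderiv_ren0 a b (f : 'I_a -> 'I_b) l p : (forall i, f i != l) ->
  mderiv l (ren f p) = 0.
Proof. by move=> fl; rewrite mderiv_ren big1 // => i _; rewrite (negPf (fl i)) mul0r. Qed.

End Rename.

(** * Splitting of the coordinates into y and z *)

Section Coordinates.
Variable R : realType.
Local Notation C := R[i].
Local Notation V := (@V R).
Variables n m : nat.
Hypothesis hm : (1 <= m <= n)%N.

(** The bounds on m keep both indices in range, so the default value of [inord] never occurs. *)
Definition yidx (a : 'I_(1 + m.-1)) : 'I_(1 + n.-1) := inord a.
Definition zidx (b : 'I_(n - m)) : 'I_(1 + n.-1) := inord (m + b).

Lemma yidxE a : yidx a = a :> nat.
Proof. by rewrite inordK //; have := ltn_ord a; lia. Qed.

Lemma zidxE b : zidx b = (m + b)%N :> nat.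
Proof. by rewrite inordK //; have := ltn_ord b; lia. Qed.

Lemma yidx_inj : injective yidx.
Proof. by move=> a b /(congr1 val) /=; rewrite !yidxE => /val_inj. Qed.

Lemma zidx_inj : injective zidx.
Proof. by move=> a b /(congr1 val) /=; rewrite !zidxE => /addnI /val_inj. Qed.

Lemma yidx_zidx a b : (yidx a == zidx b) = false.
Proof.
by apply/eqP => /(congr1 val) /=; rewrite yidxE zidxE; have := ltn_ord a; lia.
Qed.

Lemma zidx_yidx a b : (zidx a == yidx b) = false.
Proof. by rewrite eq_sym yidx_zidx. Qed.

Lemma yidx0 a : (yidx a == ord0) = (a == ord0).
Proof. by rewrite -!val_eqE /= yidxE. Qed.

Lemma zidx0 b : (zidx b == ord0) = false.
Proof. by apply/eqP => /(congr1 val) /=; rewrite zidxE; lia. Qed.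

(** Stated for any monoid law because it splits both sums over coordinates and, later, monomials
    into a y-part and a z-part. *)
Lemma big_yz (M : Type) (idx : M) (op : Monoid.law idx) (F : 'I_(1 + n.-1) -> M) :
  \big[op/idx]_i F i
  = op (\big[op/idx]_a F (yidx a)) (\big[op/idx]_b F (zidx b)).
Proof.
pose G k := F (inord k).
rewrite (eq_bigr (fun i : 'I_(1 + n.-1) => G i)) => [|i _]; last first.
  by rewrite /G inord_val.
rewrite -(big_mkord xpredT G) (@big_cat_nat _ _ _ (1 + m.-1)%N) /=; [|lia|lia].
rewrite big_mkord; congr (op _ _).
rewrite -{1}[(1 + m.-1)%N]add0n big_addn.
have -> : (1 + n.-1 - (1 + m.-1) = n - m)%N by lia.
rewrite big_mkord; apply: eq_bigr => b _; rewrite /G /zidx; congr (F (inord _)).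
by lia.
Qed.

Lemma sum_yz (M : nmodType) (F : 'I_(1 + n.-1) -> M) :
  \sum_i F i = \sum_a F (yidx a) + \sum_b F (zidx b).
Proof. exact: big_yz. Qed.

Definition yof (x : V n) : V m := \col_a x (yidx a) ord0.
Definition zof (x : V n) : 'cV[R]_(n - m) := \col_b x (zidx b) ord0.

Lemma yofE x a : yof x a ord0 = x (yidx a) ord0. Proof. by rewrite mxE. Qed.
Lemma zofE x a : zof x a ord0 = x (zidx a) ord0. Proof. by rewrite mxE. Qed.

Definition join (y : V m) (z : 'cV[R]_(n - m)) : V n :=
  \col_i if insub (val i) is Some a then y a ord0
         else if insub (i - m)%N is Some b then z b ord0 else 0.

Lemma yof_join y z : yof (join y z) = y.
Proof.
apply/matrixP => a k; rewrite [k]ord1 !mxE /=.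
case: insubP => [b _ /= bE|]; last by rewrite yidxE ltn_ord.
by congr (y _ _); apply/val_inj; rewrite /= bE yidxE.
Qed.

Lemma zof_join y z : zof (join y z) = z.
Proof.
apply/matrixP => a k; rewrite [k]ord1 !mxE /= zidxE.
case: insubP => [b /= |_]; first by have := ltn_ord a; lia.
rewrite addKn; case: insubP => [b _ /= bE|]; last by rewrite ltn_ord.
by congr (z _ _); apply/val_inj.
Qed.

Lemma eps_yidx a : eps R (yidx a) = eps R a.
Proof. by rewrite /eps yidx0. Qed.
Lemma eps_zidx b : eps R (zidx b) = - 1.
Proof. by rewrite /eps zidx0. Qed.

Lemma jdot_yz (x : V n) : jdot x x = jdot (yof x) (yof x) - dot (zof x) (zof x).
Proof.
rewrite !jdotE sum_yz dotE -sumrN; congr (_ + _); apply: eq_bigr => a _.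
  by rewrite eps_yidx !yofE.
by rewrite eps_zidx !zofE mulN1r.
Qed.

Lemma tcoord_yof (x : V n) : tcoord (yof x) = tcoord x.
Proof.
rewrite !tcoordE yofE; congr (x _ _).
by apply/eqP; rewrite yidx0.
Qed.

Local Notation iy := (ren (R := R) yidx).
Local Notation iz := (ren (R := R) zidx).

Lemma pev_iy p x : pev (iy p) x = pev p (yof x). Proof. exact: pev_ren. Qed.
Lemma pev_iz p x : pev (iz p) x = pev p (zof x). Proof. exact: pev_ren. Qed.

Lemma twd_yidx a p h : twd (yidx a) (iy p * iz h) = iy (twd a p) * iz h.
Proof.
rewrite /twd mderivM [mderiv _ (iz h)]mderiv_ren0 => [|b]; last by rewrite zidx_yidx.
rewrite mulr0 addr0 (mderiv_ren_inj _ _ yidx_inj) yidx0 raddfB /= linearZ /=.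
by rewrite mulrBl linearZ /= scalerN scalerAl.
Qed.

(** The trace of x involves only the first y-coordinate, so in the z-directions the twist by
    exp(-tr) disappears. *)
Lemma twd_zidx b p h : twd (zidx b) (iy p * iz h) = iy p * iz (mderiv b h).
Proof.
rewrite /twd mderivM [mderiv _ (iy p)]mderiv_ren0 => [|a]; last by rewrite yidx_zidx.
rewrite mul0r add0r (mderiv_ren_inj _ _ zidx_inj) zidx0.
by rewrite mul0r scale0r subr0.
Qed.

End Coordinates.

(** * Matrix entries of the embedded subalgebra *)

Section Entries.
Variable R : realType.
Local Notation C := R[i].
Local Notation V := (@V R).

Lemma Lop_entry j (a : V j) i k :
  Lop a i k = if i == ord0 then a k ord0 else if k == ord0 then a i ord0
              else (i == k)%:R * a ord0 ord0.
Proof.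
have l0 l : lshift j.-1 l = ord0 :> 'I_(1 + j.-1) by rewrite [l]ord1; apply/val_inj.
have r0 l : (rshift 1 l == ord0 :> 'I_(1 + j.-1)) = false by [].
rewrite [LHS]mxE; case: (split_ordP i) => {}i ->.
  by rewrite l0 -tcoordE tcoord_jmul -dot_split dotC dot_delta.
have td : tcoord (delta_mx k ord0 : V j) = (k == ord0)%:R.
  by rewrite tcoordE mxE eq_sym andbT.
have sd : scoord (delta_mx k ord0 : V j) i ord0 = (rshift 1 i == k)%:R.
  by rewrite scoordE mxE andbT.
rewrite r0 -[LHS]scoordE scoord_jmul mxE [X in X + _]mxE [X in _ + X]mxE sd td.
rewrite -tcoordE scoordE; case: (eqVneq k ord0) => [->|_].
  by rewrite r0 mulr0 add0r mul1r.
by rewrite mul0r addr0 mulrC.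
Qed.

Lemma ext_so_inc s p q (D : 'M[R]_p) (i k : 'I_(1 + q.-1)) :
  ext_so (j := q) (inc_so s q.-1 D) i k =
  \sum_(b < p) \sum_(c < p) (i == 1 + (s + b) :> nat)%N%:R * D b c * (k == 1 + (s + c) :> nat)%N%:R.
Proof.
rewrite /ext_so /inc_so; case: (split_ordP i) => {}i ->.
  rewrite [RHS]big1 => [|b _]; last first.
    by rewrite big1 // => c _; rewrite /= (ord1 i) !mul0r.
  case: (split_ordP k) => {}k ->; first by rewrite block_mxEul mxE.
  by rewrite block_mxEur mxE.
case: (split_ordP k) => {}k ->.
  rewrite block_mxEdl mxE big1 // => b _; rewrite big1 // => c _.
  by rewrite /= [k]ord1 mulr0.
rewrite block_mxEdr mxE exchange_big; apply: eq_bigr => c _.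
rewrite mxE mulr_suml; apply: eq_bigr => b _.
by rewrite !mxE.
Qed.

Lemma ext_so_inc0 q (D : 'M[R]_(q.-1)) : ext_so (j := q) (inc_so 0 q.-1 D) = ext_so D.
Proof.
congr ext_so; rewrite /inc_so.
have -> : shift_mx 0 q.-1 q.-1 = 1%:M :> 'M[R]_(q.-1).
  by apply/matrixP => i k; rewrite !mxE add0n.
by rewrite mul1mx trmx1 mulmx1.
Qed.

Lemma ext_soD j (A B : 'M[R]_(j.-1)) :
  ext_so (j := j) (A + B) = ext_so (j := j) A + ext_so (j := j) B.
Proof. by rewrite /ext_so add_block_mx !addr0. Qed.

(** A skew matrix has zero diagonal, and every diagonal entry of L(a) is a_1. *)
Lemma str_alg_diag j (T : 'M[R]_(1 + j.-1)) (i : 'I_(1 + j.-1)) :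
  str_alg T -> T i i = (T *m jone j) ord0 ord0.
Proof.
have so_diag (D : 'M[R]_j.-1) : so D -> forall l, D l l = 0.
  move=> soD l; have := congr1 (fun M : 'M[R]_j.-1 => M l l) (soD : D^T = - D).
  rewrite !mxE => /eqP; rewrite -addr_eq0 -mulr2n mulrn_eq0 /=.
  by move/eqP.
case=> a [D [soD TE]]; have [-> _] := str_algP TE.
rewrite TE mxE Lop_entry eqxx mul1r.
case: (split_ordP i) => {}i ->.
  rewrite /ext_so block_mxEul mxE add0r.
  by have -> : lshift j.-1 i = ord0 :> 'I_(1 + j.-1) by rewrite (ord1 i); apply/val_inj.
by rewrite /ext_so block_mxEdr so_diag // add0r.
Qed.

Lemma adjE j (T : 'M[R]_(1 + j.-1)) i k : adj (j := j) T i k = T k i.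
Proof. exact: mxE. Qed.

Section Inc.
Variables n m : nat.
Hypothesis hm : (1 <= m <= n)%N.
Local Notation yidx := (@yidx n m).
Local Notation zidx := (@zidx n m).

Lemma incV_y (u : V m) a : incV n u (yidx a) ord0 = u a ord0.
Proof.
rewrite /incV; case: (split_ordP (yidx a)) => k kE; rewrite kE.
  rewrite col_mxEu mxE; congr (u _ _); apply/val_inj.
  by have := congr1 val kE; rewrite /= yidxE // [k]ord1.
have := congr1 val kE; rewrite /= yidxE // => aE.
rewrite col_mxEd mxE; case: (split_ordP a) => b bE; first by move: aE; rewrite bE [b]ord1.
rewrite (bigD1 b) //= big1 ?addr0 => [|c /negPf cb]; rewrite !mxE.
  by rewrite bE; move: aE; rewrite bE /= add0n !add1n => -[->]; rewrite eqxx mul1r.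
case: eqP => [kc|]; last by rewrite mul0r.
by case/eqP: cb; apply/val_inj; move: aE; rewrite bE /= kc add0n !add1n => -[->].
Qed.

Lemma incV_z (u : V m) b : incV n u (zidx b) ord0 = 0.
Proof.
rewrite /incV; case: (split_ordP (zidx b)) => k kE; rewrite kE.
  by have := congr1 val kE; rewrite /= zidxE // [k]ord1 /=; lia.
have := congr1 val kE; rewrite /= zidxE // => bE.
rewrite col_mxEd mxE big1 // => c _; rewrite mxE.
case: eqP => [kc|]; last by rewrite mul0r.
by exfalso; have := ltn_ord c; lia.
Qed.

Variables (T : 'M[R]_(1 + m.-1)) (E : 'M[R]_(n - m)).
Hypothesis TP : str_alg T.

Let incTE i k : incT T E i k =
  Lop (incV n (T *m jone m : V m)) i k
  + (\sum_(b < m.-1) \sum_(c < m.-1) (i == 1 + (0 + b) :> nat)%N%:R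
       * drsubmx (T - Lop (T *m jone m : V m)) b c * (k == 1 + (0 + c) :> nat)%N%:R
  + \sum_(b < n - m) \sum_(c < n - m) (i == 1 + (m.-1 + b) :> nat)%N%:R * E b c
       * (k == 1 + (m.-1 + c) :> nat)%N%:R).
Proof.
by rewrite -!ext_so_inc /incT mxE ext_soD [X in _ + X]mxE.
Qed.

Lemma incT_yy i k : incT T E (yidx i) (yidx k) = T i k.
Proof.
case: (TP) => a [D [_ TE]]; have [aE DE] := str_algP TE.
rewrite incTE DE aE Lop_entry !yidx0 // !incV_y (inj_eq (yidx_inj hm)).
have -> : ord0 = yidx ord0 by apply/esym/eqP; rewrite yidx0.
rewrite incV_y -Lop_entry [X in _ + (_ + X)]big1 => [|b _]; last first.
  rewrite big1 // => c _; rewrite yidxE //.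
  by case: eqP => [|_]; rewrite ?mul0r //; have := ltn_ord i; lia.
by rewrite addr0 !yidxE // -ext_so_inc ext_so_inc0 TE [RHS]mxE addrC.
Qed.

Let T00 : R := (T *m jone m) ord0 ord0.

Let sum_out p q (D : 'M[R]_p) s (i k : 'I_(1 + q)) :
  (forall b : 'I_p, i <> (1 + (s + b))%N :> nat) \/
  (forall b : 'I_p, k <> (1 + (s + b))%N :> nat) ->
  \sum_(b < p) \sum_(c < p) (i == 1 + (s + b) :> nat)%N%:R * D b c
       * (k == 1 + (s + c) :> nat)%N%:R = 0.
Proof.
move=> H; rewrite big1 // => b _; rewrite big1 // => c _; case: H => H.
  by case: (_ =P (1 + (s + b))%N) => [/H//|_]; rewrite !mul0r.
by case: (_ =P (1 + (s + c))%N) => [/H//|_]; rewrite mulr0.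
Qed.

Lemma incT_yz i b : incT T E (yidx i) (zidx b) = 0.
Proof.
rewrite incTE Lop_entry zidx0 // incV_z yidx_zidx // mul0r !sum_out ?addr0.
- by case: ifP => // _; case: ifP.
- by right=> c; rewrite zidxE //; have := ltn_ord c; lia.
by left=> c; rewrite yidxE //; have := ltn_ord i; lia.
Qed.

Lemma incT_zy i b : incT T E (zidx b) (yidx i) = 0.
Proof.
rewrite incTE Lop_entry zidx0 // incV_z zidx_yidx // mul0r !sum_out ?addr0.
- by case: ifP.
- by left=> c; rewrite zidxE //; have := ltn_ord c; lia.
by right=> c; rewrite yidxE //; have := ltn_ord i; lia.
Qed.

(** L(a), taken in V_n, acts on the z-directions as the scalar a_1. Applied to a homogeneous h this
    scalar becomes k a_1, one source of the shift of lambda by k. *)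
Lemma incT_zz b c : incT T E (zidx b) (zidx c) = (b == c)%:R * T00 + E b c.
Proof.
rewrite incTE Lop_entry !zidx0 // (inj_eq (zidx_inj hm)) [X in _ + (X + _)]sum_out ?add0r; last first.
  by left=> d; rewrite zidxE //; have := ltn_ord d; lia.
congr (_ * _ + _).
  have -> : ord0 = yidx ord0 by apply/esym/eqP; rewrite yidx0.
  exact: incV_y.
have zz d (e : 'I_(n - m)) : (zidx d == 1 + (m.-1 + e) :> nat)%N = (d == e).
  by rewrite zidxE // -val_eqE /=; apply/eqP/eqP; lia.
under eq_bigr => d _ do under eq_bigr => e _ do rewrite !zz.
rewrite (bigD1 b) //= [X in _ + X]big1 => [|d /negPf db]; last first.
  by rewrite big1 // => e _; rewrite eq_sym db !mul0r.
rewrite (bigD1 c) //= [X in _ + X + _]big1 => [|d /negPf dc]; last first.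
  by rewrite [c == d]eq_sym dc mulr0.
by rewrite !eqxx mul1r mulr1 !addr0.
Qed.

Lemma adj_incT_y x a :
  (adj (incT T E) *m x) (yidx a) ord0 = (adj T *m yof m x) a ord0.
Proof.
rewrite [LHS]mxE (sum_yz hm) [X in _ + X]big1 => [|b _].
  by rewrite addr0 [RHS]mxE; apply: eq_bigr => b _; rewrite !adjE incT_yy yofE.
by rewrite adjE incT_zy mul0r.
Qed.

Lemma adj_incT_z x b :
  (adj (incT T E) *m x) (zidx b) ord0
  = T00 * zof m x b ord0 + (E^T *m zof m x) b ord0.
Proof.
rewrite [LHS]mxE (sum_yz hm) [X in X + _]big1 => [|a _]; last by rewrite adjE incT_yz mul0r.
rewrite add0r; under eq_bigr do rewrite adjE incT_zz mulrDl.
rewrite big_split /= [(E^T *m _) _ _]mxE; congr (_ + _); last first.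
  by apply: eq_bigr => c _; rewrite [E^T _ _]mxE zofE.
rewrite (bigD1 b) //= eqxx mul1r big1 ?addr0 ?zofE // => c /negPf cb.
by rewrite cb !mul0r.
Qed.

(** After the division by j in the definition of the representation the trace term is lambda a_1,
    whatever j is; this makes V_m and V_n comparable. *)
Lemma tr_str j (S : 'M[R]_(1 + j.-1)) : (0 < j)%N -> str_alg S ->
  \tr (adj S) = j%:R * (S *m jone j) ord0 ord0.
Proof.
move=> j0 SP; rewrite mxtrace_tr /mxtrace.
under eq_bigr do rewrite str_alg_diag //.
rewrite sumr_const card_ord; move: (_ ord0 ord0) => t.
by rewrite add1n prednK // mulr_natl.
Qed.

End Inc.
End Entries.

(** * Equivariance of the product map *)

Section Intertwining.
Variable R : realType.
Local Notation C := R[i].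
Local Notation V := (@V R).
Variables n m : nat.
Hypothesis hm : (1 <= m <= n)%N.
Local Notation yidx := (@yidx n m).
Local Notation zidx := (@zidx n m).
Local Notation iy := (ren (R := R) yidx).
Local Notation iz := (ren (R := R) zidx).
Local Notation yof := (@yof R n m).
Local Notation zof := (@zof R n m).

Lemma tr_incT (T : 'M[R]_(1 + m.-1)) (E : 'M[R]_(n - m)) :
  str_alg T -> so E ->
  \tr (adj (incT T E)) = n%:R * (T *m jone m) ord0 ord0.
Proof.
move=> TP soE; have n0 : (0 < n)%N by lia.
have IP : str_alg (incT T E) := @so2_inc R m n (0 : V m, T, 0 : V m) E TP soE.
rewrite (tr_str n0 IP); congr (_ * _).
case: (TP) => a [D [soD TE]]; have [aE DE] := str_algP TE.
have -> : incT T E = ext_so (inc_so 0 n.-1 D + inc_so m.-1 n.-1 E) + Lop (incV n a).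
  by rewrite -DE -aE addrC.
have [-> _] := str_algP (erefl (ext_so (inc_so 0 n.-1 D + inc_so m.-1 n.-1 E)
  + Lop (incV n a))).
have -> : ord0 = yidx ord0 by apply/esym/eqP; rewrite yidx0.
by rewrite incV_y // aE.
Qed.

Lemma pev_rot q (D : 'M[R]_q) (h : mpoly q C) z :
  pev (Defs.rot D h) z = \sum_b ((D^T *m z) b ord0)%:C * pev (mderiv b h) z.
Proof.
rewrite /Defs.rot pev_sum; apply: eq_bigr => b _.
rewrite pev_sum mxE rmorph_sum mulr_suml; apply: eq_bigr => l _ /=.
by rewrite pevZ pevM pevX rmorphM /= mulrA.
Qed.

Lemma dpoly_inc k lam (Z : triple m) (E : 'M[R]_(n - m)) p h (x : V n) :
  so2 Z -> so E -> h \in @harm_pred R (n - m) k ->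
  pev (dpoly lam (inc_triple Z E) (iy p * iz h)) x =
  pev (dpoly (lam + k%:R) Z p) (yof x) * pev h (zof x)
  + pev p (yof x) * pev (Defs.rot E h) (zof x).
Proof.
rewrite !pev_dpoly pevM pev_iy // pev_iz // pev_rot.
move=> ZP soE /andP[hk /eqP h0].
have /andP[m0 n0] : (0 < m)%N && (0 < n)%N by lia.
set y := yof x; set z := zof x.
pose p0 := pev p y; pose p1 a := pev (twd a p) y.
pose p2 a b := pev (twd a (twd b p)) y.
pose q0 := pev h z; pose q1 a := pev (mderiv a h) z.
rewrite -/p0 -/q0 -[fun a => pev (twd a p) y]/p1.
rewrite -[fun a b => pev (twd a (twd b p)) y]/p2 -/(q1 _).
rewrite (eq_bigr (fun b => ((E^T *m z) b ord0)%:C * q1 b)) //.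
have euler0 : \sum_b (z b ord0)%:C * q1 b = k%:R * q0.
  rewrite -pevZ -(eulerE hk) /euler pev_sum; apply: eq_bigr => b _.
  by rewrite pevM pevX.
have lap0 : \sum_b pev (mderiv b (mderiv b h)) z = 0.
  by rewrite -pev_sum -/(laplacian h) h0 pev0.
have P1y a : pev (twd (yidx a) (iy p * iz h)) x = p1 a * q0.
  by rewrite twd_yidx // pevM pev_iy // pev_iz.
have P1z b : pev (twd (zidx b) (iy p * iz h)) x = p0 * q1 b.
  by rewrite twd_zidx // pevM pev_iy // pev_iz.
have P2yy a b : pev (twd (yidx a) (twd (yidx b) (iy p * iz h))) x = p2 a b * q0.
  by rewrite !twd_yidx // pevM pev_iy // pev_iz.
have P2zy a b : pev (twd (zidx b) (twd (yidx a) (iy p * iz h))) x = p1 a * q1 b.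
  by rewrite twd_yidx // twd_zidx // pevM pev_iy // pev_iz.
have P2zz b : pev (twd (zidx b) (twd (zidx b) (iy p * iz h))) x
    = p0 * pev (mderiv b (mderiv b h)) z.
  by rewrite !twd_zidx // pevM pev_iy // pev_iz.
clearbody p0 p1 p2 q0 q1; case: Z ZP => [[u T] v]; rewrite /so2 /= => TP.
have t00 : (lam / n%:R * \tr (adj (incT T E)))%:C = lam%:C * ((T *m jone m) ord0 ord0)%:C.
  by rewrite tr_incT // mulrA divfK ?pnatr_eq0 -?lt0n // rmorphM.
have t01 : ((lam + k%:R) / m%:R * \tr (adj T))%:C
    = (lam%:C + k%:R) * ((T *m jone m) ord0 ord0)%:C.
  rewrite tr_str // mulrA divfK ?pnatr_eq0 -?lt0n // rmorphM rmorphD /=.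
  by rewrite rmorph_nat.
have du : dot (incV n u) x = dot u y.
  rewrite !dotE (sum_yz hm) [X in _ + X]big1 ?addr0 => [|b _].
    by apply: eq_bigr => a _; rewrite incV_y // yofE.
  by rewrite incV_z // mul0r.
have jv : jdot (incV n v) x = jdot v y.
  rewrite !jdotE (sum_yz hm) [X in _ + X]big1 ?addr0 => [|b _].
    by apply: eq_bigr => a _; rewrite incV_y // yofE eps_yidx.
  by rewrite incV_z // mul0r mulr0.
rewrite t00 t01 du jv.
(* The z-derivatives split into a_1 times the Euler field, giving k a_1, and the rotation field of
   E. *)
have -> : \sum_a ((adj (incT T E) *m x) a ord0)%:C * pev (twd a (iy p * iz h)) x =
    (\sum_a ((adj T *m y) a ord0)%:C * p1 a) * q0
    + ((T *m jone m) ord0 ord0)%:C * (k%:R * q0) * p0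
    + p0 * \sum_b ((E^T *m z) b ord0)%:C * q1 b.
  rewrite (sum_yz hm) -addrA; congr (_ + _).
    by rewrite mulr_suml; apply: eq_bigr => a _; rewrite adj_incT_y // P1y mulrA.
   rewrite -euler0 !mulr_sumr mulr_suml -big_split; apply: eq_bigr => b _ /=.
  by rewrite adj_incT_z // P1z rmorphD rmorphM /=; ring.
(* As v has no z-component, b is a y-index. When a is a z-index, Euler's formula turns the mixed
   derivatives into k (v.d), which the shifted lambda absorbs. *)
have -> : \sum_a \sum_b (x a ord0 * incV n v b ord0)%:C
      * pev (twd a (twd b (iy p * iz h))) x =
    (\sum_a \sum_b (y a ord0 * v b ord0)%:C * p2 a b) * q0
    + k%:R * q0 * \sum_b (v b ord0)%:C * p1 b.
  have H a : \sum_b (x a ord0 * incV n v b ord0)%:C * pev (twd a (twd b (iy p * iz h))) x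
     = \sum_b (x a ord0 * v b ord0)%:C * pev (twd a (twd (yidx b) (iy p * iz h))) x.
    rewrite (sum_yz hm) [X in _ + X]big1 ?addr0 => [|b _].
      by apply: eq_bigr => b _; rewrite incV_y.
    by rewrite incV_z // mulr0 mul0r.
  under eq_bigr do rewrite H.
  rewrite (sum_yz hm); congr (_ + _).
    rewrite mulr_suml; apply: eq_bigr => a _; rewrite mulr_suml.
    by apply: eq_bigr => b _; rewrite P2yy mulrA yofE.
  rewrite -euler0 mulr_suml; apply: eq_bigr => b _; rewrite mulr_sumr.
  by apply: eq_bigr => a _; rewrite P2zy zofE rmorphM /=; ring.
have -> : \sum_a (eps R a)%:C * pev (twd a (twd a (iy p * iz h))) x =
    (\sum_a (eps R a)%:C * p2 a a) * q0.
  rewrite (sum_yz hm) [X in _ + X](_ : _ = 0) ?addr0.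
    by rewrite mulr_suml; apply: eq_bigr => a _; rewrite eps_yidx // P2yy mulrA.
  transitivity (- p0 * \sum_b pev (mderiv b (mderiv b h)) z); last by rewrite lap0 mulr0.
  by rewrite mulr_sumr; apply: eq_bigr => b _; rewrite eps_zidx // P2zz rmorphN1; ring.
have -> : \sum_a (incV n v a ord0)%:C * pev (twd a (iy p * iz h)) x =
    (\sum_a (v a ord0)%:C * p1 a) * q0.
  rewrite (sum_yz hm) [X in _ + X]big1 ?addr0 => [|b _].
    by rewrite mulr_suml; apply: eq_bigr => a _; rewrite incV_y // P1y mulrA.
  by rewrite incV_z // mul0r.
rewrite rmorphD rmorph_nat.
ring.
Qed.

End Intertwining.

(** * Polynomials modulo the equation of the light cone *)

Section Decomposition.
Variable R : realType.
Local Notation C := R[i].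
Local Notation V := (@V R).
Local Notation X := (fun l => mpolyX C (mnm1 l)).

Lemma sum_trunc (M : nmodType) N1 N (F : nat -> M) : (N1 <= N)%N ->
  \sum_(k < N) (if (k < N1)%N then F k else 0) = \sum_(k < N1) F k.
Proof. by move=> leN; rewrite (big_ord_widen _ F leN) [RHS]big_mkcond. Qed.

Definition hdim q k := bdim (harm_basis R q k).
Definition hvec q k (i : 'I_(hdim q k)) : harm_space q k := bvec i.

Definition light_cone j : set (V j) := [set x | 0 < tcoord x /\ jdot x x = 0].

Section Fixed.
Variables n m : nat.
Hypothesis hm : (1 <= m <= n)%N.
Local Notation yidx := (@yidx n m).
Local Notation zidx := (@zidx n m).
Local Notation iy := (ren (R := R) yidx).
Local Notation iz := (ren (R := R) zidx).
Local Notation yof := (@yof R n m).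
Local Notation zof := (@zof R n m).
Local Notation q := (n - m)%N.

Definition harm_comb (x : forall k, 'I_(hdim q k) -> mpoly (1 + m.-1) C) k :
    mpoly (1 + n.-1) C :=
  \sum_i iy (x k i) * iz (val (hvec i)).

Lemma pev_harm_comb k (p : 'I_(hdim q k) -> mpoly (1 + m.-1) C) x :
  pev (\sum_i iy (p i) * iz (val (hvec i))) x
  = \sum_i pev (p i) (yof x) * pev (val (hvec i)) (zof x).
Proof.
by rewrite pev_sum; apply: eq_bigr => i _; rewrite pevM pev_iy // pev_iz.
Qed.

Definition fischer_decomp (p : mpoly (1 + n.-1) C) := exists N x G,
  p = \sum_(k < N) harm_comb x k + G * qform R n.

Lemma fischer_decompD p r : fischer_decomp p -> fischer_decomp r -> fischer_decomp (p + r).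
Proof.
move=> [N1 [x1 [G1 ->]]] [N2 [x2 [G2 ->]]].
(* Each family is cut off at its own bound, because its members beyond that bound are arbitrary. *)
exists (N1 + N2)%N, (fun k i => (if (k < N1)%N then x1 k i else 0)
  + (if (k < N2)%N then x2 k i else 0)), (G1 + G2).
rewrite mulrDl addrACA; congr (_ + _).
rewrite -(sum_trunc _ (leq_addr N2 N1)) -(sum_trunc _ (leq_addl N1 N2)).
rewrite -big_split; apply: eq_bigr => k _ /=; rewrite /harm_comb.
have E b (F : 'I_(hdim q k) -> mpoly (1 + m.-1) C) :
    (if b then \sum_i iy (F i) * iz (val (hvec i)) else 0)
    = \sum_i iy (if b then F i else 0) * iz (val (hvec i)).
  case: b => //; rewrite big1 // => i _.
  by rewrite raddf0 mul0r.
rewrite !E -big_split; apply: eq_bigr => i _ /=.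
by rewrite raddfD /= mulrDl.
Qed.

Lemma fischer_decomp_ideal G : fischer_decomp (G * qform R n).
Proof.
exists 0%N, (fun _ _ => 0), G; by rewrite big_ord0 add0r.
Qed.

Lemma fischer_decomp_harm d r (g : mpoly q C) : g \in @harm_pred R q d -> fischer_decomp (iy r * iz g).
Proof.
(* The type of harmonics depends on k, so g is injected by [insub], with coordinates 0 where that
   fails; the factor [(k == d)%:R] leaves only degree d. *)
move=> gd; exists d.+1, (fun k i => ((k == d)%:R *
  if insub g is Some h then bcoord (f := harm_basis R q k) i h else 0) *: r), 0.
rewrite mul0r addr0 big_ord_recr /= big1 => [|k _]; last first.
  rewrite /harm_comb big1 // => i _; rewrite (ltn_eqF (ltn_ord k)) mul0r scale0r.
  by rewrite raddf0 mul0r.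
rewrite add0r /harm_comb eqxx insubT /=.
have {1}-> : g = \sum_i bcoord i (HarmSpace gd : harm_space q d) *: val (hvec i).
  rewrite -[LHS]/(val (HarmSpace gd : harm_space q d)).
  rewrite -[in LHS](bcoordK (harm_basis R q d) (HarmSpace gd)).
  by rewrite raddf_sum; apply: eq_bigr.
rewrite raddf_sum mulr_sumr; apply: eq_bigr => i _ /=.
by rewrite mul1r !linearZ /= -scalerAr -scalerAl.
Qed.

Lemma qform_yz : qform R n = iy (qform R m) - iz (rsq R q).
Proof.
rewrite /qform (sum_yz hm) /rsq !raddf_sum.
congr (_ + _); apply: eq_bigr => a _ /=.
  by rewrite linearZ /= renM renX eps_yidx.
by rewrite renM renX eps_zidx // rmorphN1 scaleN1r.
Qed.

(** Since Delta(x) = Delta(y) - |z|^2, a factor |z|^2 can be traded for Delta(y) modulo Delta(x),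
    which lowers the degree in z. The coefficient r is arbitrary so that it can absorb Delta(y) in
    the induction. *)
Lemma fischer_decomp_homog d r (g : mpoly q C) : g \is ishomog1 d mdeg ->
  fischer_decomp (iy r * iz g).
Proof.
elim/ltn_ind: d r g => d IH r g /fischer[/fischer_decomp_harm//|[h [g' [hh g'd d2 ->]]]].
have -> : iy r * iz (h + rsq R q * g') = iy r * iz h +
   (iy (r * qform R m) * iz g' + (- (iy r * iz g')) * qform R n).
  rewrite qform_yz raddfD /= !renM; ring.
by apply: fischer_decompD (fischer_decomp_harm _ hh) _; apply: fischer_decompD (fischer_decomp_ideal _); apply: (IH d.-2); first lia.
Qed.

Lemma fischer_decomposition p : fischer_decomp p.
Proof.
elim/mpoly_lin_ind: p => [|p r|c p [N [x [G ->]]]|mo]; last 2 first.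
- exists N, (fun k i => c *: x k i), (c *: G).
  rewrite scalerDr scaler_sumr -scalerAl; congr (_ + _); apply: eq_bigr => k _.
  rewrite /harm_comb scaler_sumr; apply: eq_bigr => i _.
  by rewrite linearZ /= scalerAl.
- have -> : mpolyX C mo = iy (\prod_a X a ^+ mo (yidx a)) * iz (\prod_b X b ^+ mo (zidx b)).
    have rX a b (f : 'I_a -> 'I_b) (e : 'I_a -> nat) :
        ren f (\prod_i X i ^+ e i) = \prod_i X (f i) ^+ e i :> mpoly b C.
      have r1 : ren f (1 : mpoly a C) = 1 by rewrite renE comp_mpoly1.
      apply: (big_ind2 (fun p q => ren f p = q)) => // [p p' r r' <- <-|i _].
        exact: renM.
      by elim: (e i) => // k IH; rewrite !exprS renM renX IH.
    rewrite !rX mpolyXE_id.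
    exact: (big_yz hm).
  have -> : \prod_b X b ^+ mo (zidx b) = mpolyX C (Multinom [tuple mo (zidx b) | b < q]) :> mpoly q C.
    rewrite mpolyXE_id; apply: eq_bigr => b _; by rewrite mnmE.
  by apply: fischer_decomp_homog; rewrite dhomogX.
- by rewrite -[0](mul0r (qform R n)); apply: fischer_decomp_ideal.
exact: fischer_decompD.
Qed.

Lemma hvec_free k (c : 'I_(hdim q k) -> C) :
  \sum_i c i *: val (hvec i) = 0 -> forall i, c i = 0.
Proof.
move=> S0 i; have := bcoord_sum (f := harm_basis R q k) c i.
rewrite (_ : \sum_i _ = 0).
  have := bcoord_lin (f := harm_basis R q k) i (-1) 0 0.
  by rewrite scaler0 addr0 /= mulN1r addNr => -> <-.
by apply/val_inj; rewrite raddf_sum -[RHS]S0; apply: eq_bigr.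
Qed.

Lemma harm_comb_sphere_eq0 N (c : forall k, 'I_(hdim q k) -> C) (y : V m) :
  (0 < q)%N -> open_cone y ->
  (forall x : V n, light_cone x -> yof x = y ->
     \sum_(k < N) \sum_i c k i * pev (val (hvec i : harm_space q k)) (zof x) = 0) ->
  forall k, (k < N)%N -> forall i, c k i = 0.
Proof.
move=> q0 [y0 yy] H k kN; apply: hvec_free.
apply: (harm_sphere (h := fun k => \sum_i c k i *: val (hvec i)) q0 yy _ _ kN).
  by move=> l _; apply: rpred_sum => i _; apply: rpredZ; case: (hvec i).
move=> z zy; rewrite -[RHS](H (join y z)) ?yof_join //.
  apply: eq_bigr => l _; rewrite pev_sum zof_join //.
  by apply: eq_bigr => i _; rewrite pevZ.
split; first by rewrite -(tcoord_yof hm) yof_join.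
by rewrite (jdot_yz hm) yof_join // zof_join // zy subrr.
Qed.

End Fixed.

Lemma light_cone_div n (p : mpoly (1 + n.-1) C) : (2 <= n)%N ->
  (forall x : V n, light_cone x -> pev p x = 0) -> exists G, p = G * qform R n.
Proof.
move=> n2 pE; have hm : (1 <= 1 <= n)%N by lia.
(* In V_1 the open cone is the half-line y > 0, and the light cone lies over y as a sphere in
   R^(n-1). *)
have [N [x [G pG]]] := @fischer_decomposition n 1 hm p.
exists G; rewrite pG big1 ?add0r // => k _; rewrite /harm_comb big1 // => i _.
have -> : x k i = 0.
  apply: (@pev_open_cone_eq0 _ 1) => y yc.
  apply: (@harm_comb_sphere_eq0 n 1 hm N (fun k i => pev (x k i) y) y _ yc _ k (ltn_ord k)); first lia.
  move=> w wl wy; rewrite -[RHS](pE w wl) pG pevD pevM pev_qform.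
  case: wl => _ ->; rewrite mulr0 addr0 pev_sum; apply: eq_bigr => l _.
  by rewrite /harm_comb pev_harm_comb wy.
by rewrite raddf0 mul0r.
Qed.

End Decomposition.

(** * The module structure *)

Section Representation.
Variable R : realType.
Local Notation C := R[i].
Local Notation V := (@V R).

Lemma orbit_light n (x : V n) : (3 <= n)%N ->
  orbit n ((n%:R - 2) / 2) x <-> light_cone x.
Proof.
move=> n3; rewrite /orbit /light_cone /= n3 eqxx /= /jdot -expr2.
split=> [[xx x0]|[x0 /eqP]]; first by rewrite xx subrr.
by rewrite subr_eq0 => /eqP.
Qed.

Lemma orbit_cone j lam (x : V j) :
  ~~ ((3 <= j)%N && (lam == (j%:R - 2) / 2)) -> orbit j lam x <-> open_cone x.
Proof. by rewrite /orbit /= => /negPf ->; exact: open_coneP. Qed.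

Lemma opval_linear j lam (Z : triple j) (x : V j) c P P' P1 P1' P2 P2' :
  opval lam Z x (c * P + P') (fun a => c * P1 a + P1' a)
    (fun a b => c * P2 a b + P2' a b)
  = c * opval lam Z x P P1 P2 + opval lam Z x P' P1' P2'.
Proof.
have S I (F G H : I -> C) (r : seq I) :
    \sum_(i <- r) F i * (c * G i + H i)
    = c * (\sum_(i <- r) F i * G i) + \sum_(i <- r) F i * H i.
  rewrite mulr_sumr -big_split; apply: eq_bigr => i _ /=; ring.
case: Z => [[u T] v] /=; rewrite !S.
under eq_bigr do rewrite S.
by rewrite big_split /= -mulr_sumr; ring.
Qed.

Lemma pev_dpoly_linear j lam (Z : triple j) c p q (x : V j) :
  pev (dpoly lam Z (c *: p + q)) x
  = c * pev (dpoly lam Z p) x + pev (dpoly lam Z q) x.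
Proof.
pose A r a := pev (twd a r) x; pose B r a b := pev (twd a (twd b r)) x.
have E r : pev (dpoly lam Z r) x = opval lam Z x (pev r x) (A r) (B r).
  exact: pev_dpoly.
transitivity (c * opval lam Z x (pev p x) (A p) (B p)
  + opval lam Z x (pev q x) (A q) (B q)); last by congr (_ * _ + _); rewrite E.
etransitivity; first exact: E.
etransitivity; last exact: (opval_linear lam Z x c (pev p x) (pev q x)
  (A p) (A q) (B p) (B q)).
congr opval; first by rewrite pevD pevZ.
  by apply/funext => a; rewrite /A linearP pevD pevZ.
by apply/funext => a; apply/funext => b; rewrite /B !linearP pevD pevZ.
Qed.

Lemma pev_dpoly0 j lam (Z : triple j) (x : V j) : pev (dpoly lam Z 0) x = 0.
Proof.
have := pev_dpoly_linear lam Z (-1) 0 0 x.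
by rewrite scaler0 addr0 mulN1r addNr.
Qed.

(** Makes the action independent of the representing polynomial: one that vanishes on the light cone
    is a multiple of Delta, and one that vanishes on the open cone is zero. *)
Lemma dpoly_orbit j (lam : R) (Z : triple j) (p : mpoly (1 + j.-1) C) : so2 Z ->
  (forall x, orbit j lam x -> pev p x = 0) ->
  forall x, orbit j lam x -> pev (dpoly lam Z p) x = 0.
Proof.
move=> ZP p0 x; have [/andP[j3 /eqP lamE]|nl] :=
  boolP ((3 <= j)%N && (lam == (j%:R - 2) / 2)).
  rewrite lamE => /(orbit_light _ j3) xl.
  have [G ->] : exists G, p = G * qform R j.
    apply: light_cone_div => [|y]; first lia.
    by move=> /(orbit_light _ j3); rewrite -lamE; exact: p0.
  by apply: dpoly_light => //; [lia|case: xl].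
have -> : p = 0 by apply: pev_open_cone_eq0 => y /(orbit_cone _ nl) /p0.
by rewrite pev_dpoly0.
Qed.

Section HwSpace.
Variables (j : nat) (lam : R).
Local Notation hw := (@hw_space R j lam).

Lemma polexp_congr (p q : mpoly (1 + j.-1) C) (x : V j) :
  pev p x = pev q x -> polexp p x = polexp q x.
Proof. by rewrite !polexpE => ->. Qed.

Lemma hw_of_subproof (p : mpoly (1 + j.-1) C) :
  (fun x : orbit j lam => polexp p (val x) : C^o) \in @hw_pred R j lam.
Proof. by apply/asboolP; exists p. Qed.

Definition hw_of p : hw := HwSpace (hw_of_subproof p).

Lemma hw_rep_ex (f : hw) : exists p, forall x, f x = polexp p (val x).
Proof. by case: f => f /= /asboolP. Qed.

Definition hw_rep (f : hw) := sval (cid (hw_rep_ex f)).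

Lemma hw_repP (f : hw) x : f x = polexp (hw_rep f) (val x).
Proof. exact: (svalP (cid (hw_rep_ex f))). Qed.

Lemma hwP (f g : hw) : (forall x, f x = g x) -> f = g.
Proof. by move=> fg; apply/val_inj/funext. Qed.

Lemma hw_linE c (f g : hw) x : (c *: f + g) x = c * f x + g x.
Proof. by []. Qed.

Lemma hw_addE (f g : hw) x : (f + g) x = f x + g x.
Proof. by []. Qed.

Lemma hw_scaleE c (f : hw) x : (c *: f) x = c * f x.
Proof. by []. Qed.

Lemma hw_sumE I r (P : pred I) (F : I -> hw) x :
  (\sum_(i <- r | P i) F i) x = \sum_(i <- r | P i) F i x.
Proof. by elim/big_rec2: _ => // i y f _ <-. Qed.

Lemma expC_neq0 (t : R) : (expR t)%:C != 0.
Proof. by rewrite (fmorph_eq0 (real_complex R)) gt_eqF // expR_gt0. Qed.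

(** The set in [dpi_act] is inhabited, by [hw_of] of the transformed polynomial, so [xget] does not
    return its default 0; any representative p may then be used. *)
Lemma dpi_actP (Z : @so2 R j) (f : hw) p :
  (forall x, f x = polexp p (val x)) ->
  forall x, dpi_act Z f x = polexp (dpoly lam (val Z) p) (val x).
Proof.
move=> fp; pose P : set hw := [set g : hw | forall p : mpoly (1 + j.-1) R[i],
    (forall x : orbit j lam, f x = polexp p (val x)) ->
    forall x : orbit j lam,
      g x = dpi_fun lam (val Z) (polexp p) (val x)]%classic.
have Pg : P (hw_of (dpoly lam (val Z) p)).
  move=> r fr x; transitivity (polexp (dpoly lam (val Z) r) (val x)); last first.
    by symmetry; exact: dpi_polexp.
  apply: polexp_congr; apply/eqP; rewrite -subr_eq0; apply/eqP.
  have z0 y : orbit j lam y -> pev (-1 *: r + p) y = 0.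
    move=> yo; have := fp (exist _ y (mem_set yo)).
    rewrite fr !polexpE /= => /(mulIf (expC_neq0 _)) E.
    by rewrite pevD pevZ mulN1r E addNr.
  have := dpoly_orbit (set_mem (valP Z)) z0 (set_mem (valP x)).
  by rewrite pev_dpoly_linear mulN1r addrC.
move=> x; have : P (dpi_act Z f) := xgetPex 0 (ex_intro _ _ Pg).
by move=> /(_ p fp x) ->; rewrite dpi_polexp.
Qed.

Lemma dpi_act_linear (Z : @so2 R j) : linear (@dpi_act R j lam Z).
Proof.
move=> c f g; apply: hwP => x.
rewrite hw_linE (dpi_actP Z (hw_repP f)) (dpi_actP Z (hw_repP g)).
rewrite (@dpi_actP _ _ (c *: hw_rep f + hw_rep g)) => [|y].
  by rewrite !polexpE pev_dpoly_linear mulrDl mulrA.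
by rewrite hw_linE !hw_repP !polexpE pevD pevZ mulrDl mulrA.
Qed.

Lemma dpi_act_sum (Z : @so2 R j) I r (F : I -> hw) :
  dpi_act Z (\sum_(i <- r) F i) = \sum_(i <- r) dpi_act Z (F i).
Proof.
pose L := HB.pack_for {linear hw -> hw} (@dpi_act R j lam Z)
  (GRing.isLinear.Build _ _ _ _ _ (dpi_act_linear Z)).
exact: (linear_sum L).
Qed.

Lemma dpi_actZ (Z : @so2 R j) c (f : hw) : dpi_act Z (c *: f) = c *: dpi_act Z f.
Proof.
pose L := HB.pack_for {linear hw -> hw} (@dpi_act R j lam Z)
  (GRing.isLinear.Build _ _ _ _ _ (dpi_act_linear Z)).
exact: (linearZ_LR L).
Qed.

End HwSpace.

End Representation.

(** * The branching law *)

Section Branching.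
Variable R : realType.
Local Notation C := R[i].
Local Notation V := (@V R).
Variables n m : nat.
Hypotheses (hn : (3 <= n)%N) (hm : (1 <= m <= n)%N).
Local Notation q := (n - m)%N.
Local Notation iy := (ren (R := R) (@yidx n m)).
Local Notation iz := (ren (R := R) (@zidx n m)).
Local Notation yof := (@yof R n m).
Local Notation zof := (@zof R n m).
Let lambda : R := (n%:R - 2) / 2.
Local Notation Y k := (orbit m (lambda + k%:R)).
Local Notation A k := (@hw_space R m (lambda + k%:R)).
Local Notation W := (@hw_space R n lambda).
Local Notation harm k := (@harm_space R q k).
Local Notation d k := (hdim R q k).

Definition coords k (i : 'I_(d k)) (h : harm k) : C^o := bcoord i h.

Lemma coords_linear k i : scalar (@coords k i).
Proof. exact: bcoord_lin. Qed.
HB.instance Definition _ k i := GRing.isLinear.Build C (harm k) C^o _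
  (@coords k i) (@coords_linear k i).

Lemma coordsK k (h : harm k) : \sum_i coords i h *: hvec i = h.
Proof. exact: bcoordK. Qed.

Lemma coords_sum k (c : 'I_(d k) -> C) j : coords j (\sum_i c i *: hvec i) = c j.
Proof. exact: bcoord_sum. Qed.

Lemma harm_act_linear k (D : @so R q) : linear (@harm_act R q k D).
Proof.
move=> c g h; apply/val_inj => /=; rewrite /Defs.rot scaler_sumr -big_split.
apply: eq_bigr => i _ /=; rewrite scaler_sumr -big_split; apply: eq_bigr => l _ /=.
by rewrite mderivD mderivZ mulrDr scalerDr -scalerAr !scalerA mulrC.
Qed.
HB.instance Definition _ k D := GRing.isLinear.Build C _ _ _
  (@harm_act R q k D) (@harm_act_linear k D).

Lemma coords_act k (D : @so R q) (h : harm k) i :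
  coords i (harm_act D h) = \sum_l coords i (harm_act D (hvec l : harm k)) * coords l h.
Proof.
rewrite -{1}(coordsK h) !linear_sum; apply: eq_bigr => l _.
by rewrite !linearZ /= mulrC.
Qed.

Lemma pev_harm0 k (h : harm k) z : q = 0%N -> (0 < k)%N -> pev (val h) z = 0.
Proof.
case: h => h /= /andP[hk _] q0 k0; rewrite pevE mevalE big_seq big1 // => mo.
move=> /(dhomog_mf hk) /=; rewrite mdegE big1 => [k0'|i _]; first by rewrite -k0' in k0.
by exfalso; have := ltn_ord i; lia.
Qed.

(** Here lambda + k is at least (n-2)/2, strictly above the discrete Wallach point (m-2)/2 of
    V_m. *)
Lemma orbit_lt k (y : V m) : (m < n)%N -> Y k y <-> open_cone y.
Proof.
move=> mn; apply: orbit_cone; rewrite negb_and; apply/orP; right.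
rewrite gt_eqF // /lambda ltr_wpDr ?ler0n // ltr_pM2r ?invr_gt0 ?ltr0n //.
by rewrite ltrD2r ltr_nat.
Qed.

Lemma orbit_eq (y : V m) : m = n -> Y 0 y <-> light_cone y.
Proof.
move=> mn; have m3 : (3 <= m)%N by rewrite mn.
have -> : lambda + 0%:R = (m%:R - 2) / 2 by rewrite addr0 mn.
exact: orbit_light.
Qed.

Lemma light_cone_yof (x : V n) : m = n -> light_cone x -> Y 0 (yof x).
Proof.
move=> mn [x0 xx]; apply/(orbit_eq _ mn).
split; first by rewrite tcoord_yof.
rewrite -xx (jdot_yz hm) [dot (zof x) _]dotE big1 ?subr0 // => i _.
by exfalso; have := ltn_ord i; lia.
Qed.

(* A polynomial that represents an element of [A k] is unique modulo polynomials
   vanishing on the orbit, which for [m = n] is the light cone. *)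
Lemma orbit_mul0 k p (h : harm k) (x : V n) :
  (forall y, Y k y -> pev p y = 0) -> light_cone x -> pev p (yof x) * pev (val h) (zof x) = 0.
Proof.
move=> p0 xl; have [mn|mn] := ltnP m n.
  have -> : p = 0 by apply: pev_open_cone_eq0 => y /(orbit_lt k _ mn) /p0.
  by rewrite pev0 mul0r.
have mE : m = n by lia.
have [k0|k0] := posnP k; last by rewrite pev_harm0 ?mulr0 //; lia.
by move: h p0; rewrite k0 => h p0; rewrite p0 ?mul0r //; exact: light_cone_yof.
Qed.

(** The tensor product with the harmonics of degree k is modelled by families indexed by a basis of
    that space. Representatives are chosen by [hw_rep]; [branch_embE] shows that the choice does not
    matter. *)
Definition branch_emb k (a : {ffun 'I_(d k) -> A k}) : W :=
  hw_of lambda (\sum_i iy (hw_rep (a i)) * iz (val (hvec i))).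

Lemma orbit_light_val (x : orbit n lambda) : light_cone (val x).
Proof. by apply/(orbit_light _ hn); exact: set_mem (valP x). Qed.

Lemma branch_embE k (a : {ffun 'I_(d k) -> A k}) (p : 'I_(d k) -> mpoly (1 + m.-1) C) :
  (forall i y, a i y = polexp (p i) (val y)) ->
  forall x, branch_emb a x = polexp (\sum_i iy (p i) * iz (val (hvec i))) (val x).
Proof.
move=> ap x; rewrite /branch_emb /=; apply: polexp_congr; rewrite !pev_harm_comb.
apply: eq_bigr => i _; apply/eqP; rewrite -subr_eq0 -mulrBl -pevB; apply/eqP.
apply: orbit_mul0 (orbit_light_val x) => y yo.
have := ap i (exist _ y (mem_set yo)); rewrite hw_repP !polexpE /=.
by move=> /(mulIf (expC_neq0 _)) E; rewrite pevB E subrr.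
Qed.

Lemma branch_emb_linear k : linear (@branch_emb k).
Proof.
move=> c a b; apply: hwP => x.
rewrite (@branch_embE _ _ (fun i => c *: hw_rep (a i) + hw_rep (b i))) => [|i y].
  rewrite hw_linE (branch_embE (fun i => hw_repP (a i))) (branch_embE (fun i => hw_repP (b i))).
  rewrite !polexpE !pev_harm_comb mulrA -mulrDl mulr_sumr -big_split; congr (_ * _).
  by apply: eq_bigr => i _ /=; rewrite pevD pevZ; ring.
by rewrite !ffunE hw_linE !hw_repP !polexpE pevD pevZ; ring.
Qed.
HB.instance Definition _ k := GRing.isLinear.Build C _ _ _ (@branch_emb k) (@branch_emb_linear k).

Definition branch_act k (Z : @h_alg R m n) (a : {ffun 'I_(d k) -> A k}) :
    {ffun 'I_(d k) -> A k} :=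
  [ffun i => dpi_act Z.1 (a i)
    + \sum_l coords i (harm_act Z.2 (hvec l : harm k)) *: a l].

Definition branch k : gmod (@h_alg R m n) := GMod (@branch_act k).

Definition hw_tensor k (f : A k) (h : harm k) : {ffun 'I_(d k) -> A k} :=
  [ffun i => coords i h *: f].

Lemma hw_tensor_bilinear k : bilinear_for *:%R *:%R (@hw_tensor k).
Proof.
split=> [h c f g|f c g h]; apply/ffunP => i; rewrite !ffunE.
  by rewrite scalerDr !scalerA mulrC.
by rewrite coords_linear /= scalerDl scalerA.
Qed.
HB.instance Definition _ k := bilinear_isBilinear.Build C _ _ _ _ _ (@hw_tensor k) (@hw_tensor_bilinear k).

Lemma hw_tensor_decomp k (a : {ffun 'I_(d k) -> A k}) : a = \sum_i hw_tensor (a i) (hvec i).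
Proof.
apply/ffunP => j; rewrite sum_ffunE.
have cd i : coords j (hvec i : harm k) = (i == j)%:R.
  rewrite -(coords_sum (fun l => (i == l)%:R) j); congr coords.
  rewrite (bigD1 i) //= eqxx scale1r big1 ?addr0 // => l.
  by rewrite eq_sym => /negPf ->; rewrite scale0r.
rewrite (bigD1 j) //= ffunE cd eqxx scale1r big1 ?addr0 // => i /negPf ij.
by rewrite ffunE cd ij scale0r.
Qed.

(** A family is the sum of its components tensored with the basis vectors, which prescribes the
    induced map. *)
Lemma hw_tensorP k : is_tensor (@hw_tensor k).
Proof.
move=> M b; pose F (a : {ffun 'I_(d k) -> A k}) : M := \sum_i b (a i) (hvec i).
have F_lin : linear F.
  move=> c a a'; rewrite /F scaler_sumr -big_split; apply: eq_bigr => i _ /=.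
  by rewrite !ffunE linearPl.
pose F' := HB.pack_for {linear {ffun 'I_(d k) -> A k} -> M} F
  (GRing.isLinear.Build _ _ _ _ _ F_lin).
have FE f h : F' (hw_tensor f h) = b f h.
  rewrite /= /F -[in RHS](coordsK h) linear_sumr; apply: eq_bigr => i _.
  by rewrite ffunE linearZl linearZr.
exists F'; split=> // f' f'E a; rewrite [in LHS](hw_tensor_decomp a) [in RHS](hw_tensor_decomp a).
by rewrite !linear_sum; apply: eq_bigr => i _; rewrite FE f'E.
Qed.

Lemma branch_tensor k :
  is_outer_tensor (dpi m (lambda + k%:R)) (harmonics R (n - m) k) (branch k).
Proof.
exists (@hw_tensor k); first exact: hw_tensorP.
move=> Z N f h; apply/ffunP => i; rewrite /= /branch_act ffunE !sum_ffunE.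
have -> : \sum_l coords i (harm_act Z.2 (hvec l : harm k)) *: (\sum_(j < N) hw_tensor (f j) (h j)) l
    = \sum_(j < N) coords i (harm_act Z.2 (h j)) *: f j.
  under eq_bigr do rewrite sum_ffunE scaler_sumr.
  rewrite exchange_big; apply: eq_bigr => j _ /=.
  rewrite coords_act scaler_suml; apply: eq_bigr => l _.
  by rewrite ffunE scalerA.
rewrite dpi_act_sum -big_split; apply: eq_bigr => j _ /=.
by rewrite !ffunE dpi_actZ.
Qed.

Lemma branch_emb_act k (Z : @h_alg R m n) (a : {ffun 'I_(d k) -> A k}) :
  dpi_act (inc Z) (branch_emb a) = branch_emb (branch_act Z a).
Proof.
apply: hwP => x; pose p i := hw_rep (a i).
pose c i l := coords i (harm_act Z.2 (hvec l : harm k)).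
have ap i := hw_repP (a i).
rewrite (dpi_actP _ (branch_embE ap)).
(* Polynomials computed from those of a replace the unknown representatives of [branch_act Z a]. *)
rewrite (@branch_embE _ _ (fun i => dpoly (lambda + k%:R) (val Z.1) (p i) + \sum_l c i l *: p l)); last first.
  move=> i y; rewrite ffunE hw_addE hw_sumE (dpi_actP _ (ap i)) !polexpE pevD mulrDl.
  congr (_ + _); rewrite pev_sum mulr_suml; apply: eq_bigr => l _.
  by rewrite hw_scaleE ap polexpE pevZ mulrA.
apply: polexp_congr; rewrite pev_harm_comb.
have dsum I r (F : I -> mpoly (1 + n.-1) C) : pev (dpoly lambda (val (inc Z)) (\sum_(i <- r) F i)) (val x)
    = \sum_(i <- r) pev (dpoly lambda (val (inc Z)) (F i)) (val x).
  elim: r => [|i r IH]; first by rewrite !big_nil pev_dpoly0.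
  by rewrite !big_cons -[F i]scale1r pev_dpoly_linear mul1r scale1r IH.
rewrite dsum /=.
have rotE i : pev (Defs.rot (val Z.2) (val (hvec i : harm k))) (zof (val x))
    = \sum_l c l i * pev (val (hvec l : harm k)) (zof (val x)).
  transitivity (pev (val (\sum_l c l i *: (hvec l : harm k))) (zof (val x))).
    by rewrite coordsK.
  by rewrite raddf_sum pev_sum; apply: eq_bigr => l _; rewrite -pevZ.
under eq_bigr => i _.
  rewrite (dpoly_inc hm _ _ _ (set_mem (valP Z.1)) (set_mem (valP Z.2)) (harm_valP (hvec i))).
  rewrite rotE mulr_sumr; over.
(* Exchanging the sums moves the matrix of the rotation from the basis vectors to the
   coefficients. *)
rewrite big_split /= exchange_big -big_split; apply: eq_bigr => i _ /=.
rewrite pevD mulrDl pev_sum mulr_suml; congr (_ + _); apply: eq_bigr => l _.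
by rewrite pevZ; ring.
Qed.

Lemma branch_emb_span (w : W) : exists N (a : forall k, {ffun 'I_(d k) -> A k}),
  w = \sum_(k < N) branch_emb (a k).
Proof.
have [N [p [G pG]]] := fischer_decomposition hm (hw_rep w).
exists N, (fun k => [ffun i => hw_of (lambda + k%:R) (p k i)]); apply: hwP => x.
rewrite hw_sumE hw_repP pG.
rewrite (eq_bigr (fun k : 'I_N => polexp (harm_comb p k) (val x))) => [|k _]; last first.
  by rewrite (@branch_embE _ _ (p k)) // => i y; rewrite ffunE.
rewrite polexpE pevD pevM pev_qform (orbit_light_val x).2 mulr0 addr0 pev_sum mulr_suml.
by apply: eq_bigr => k _; rewrite polexpE.
Qed.

Lemma hw_of_eq0 k (f : A k) : (forall y, Y k y -> pev (hw_rep f) y = 0) -> f = 0.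
Proof.
move=> f0; apply: hwP => y; rewrite hw_repP polexpE f0 ?mul0r //.
exact: set_mem (valP y).
Qed.

Lemma branch_emb_inj N (a : forall k, {ffun 'I_(d k) -> A k}) :
  \sum_(k < N) branch_emb (a k) = 0 -> forall k, (k < N)%N -> a k = 0.
Proof.
move=> a0; pose p k i := hw_rep (a k i).
have S0 x : light_cone x -> \sum_(k < N) \sum_i pev (p k i) (yof x) * pev (val (hvec i : harm k)) (zof x) = 0.
  move=> /(orbit_light _ hn) xo.
  have := congr1 (fun f : W => f (exist _ x (mem_set xo))) a0.
  rewrite hw_sumE (eq_bigr (fun k : 'I_N => polexp (harm_comb (p : forall k, _) k) x)) => [|k _]; last first.
    exact: (branch_embE (fun i => hw_repP (a k i))).
  under eq_bigr do rewrite polexpE pev_harm_comb.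
  rewrite -mulr_suml => /eqP; rewrite mulf_eq0 (negPf (expC_neq0 _)) orbF => /eqP.
  exact.
move=> k kN; apply/ffunP => i; rewrite ffunE; apply: hw_of_eq0 => y yo.
have [mn|mn] := ltnP m n.
  have q0 : (0 < n - m)%N by lia.
  have yc : open_cone y by exact/(orbit_lt k y mn).
  apply: (harm_comb_sphere_eq0 hm (c := fun k i => pev (p k i) y) q0 yc _ kN) => x xl xy.
  by rewrite -xy S0.
(* Now m = n: harmonics of positive degree have value 0 and only the summand k = 0 remains, which is
   evaluated at points y of the light cone. *)
have q0 : (n - m = 0)%N by lia.
apply: (hvec_free (c := fun i => pev (p k i) y)).
suff vE z : \sum_i pev (p k i) y * pev (val (hvec i : harm k)) z = 0.
  by apply: pev_eq0 => z; rewrite pev_sum -[RHS](vE z); apply: eq_bigr => l _; rewrite pevZ.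
have [k0|k0] := posnP k; last by rewrite big1 // => l _; rewrite pev_harm0 ?mulr0.
subst k; have mn' : m = n by lia.
have [y0 yy] := (orbit_eq y mn').1 yo.
have xl : light_cone (join y z).
  split; first by rewrite -(tcoord_yof hm) yof_join.
  rewrite (jdot_yz hm) yof_join // yy dotE big1 ?subr0 // => l _.
  by exfalso; have := ltn_ord l; lia.
have := S0 _ xl; rewrite yof_join // zof_join // (bigD1 (Ordinal kN)) //=.
rewrite [X in _ + X]big1 ?addr0 // => l l0; rewrite big1 // => e _.
by rewrite pev_harm0 ?mulr0 // lt0n.
Qed.

Lemma branch_sum : is_direct_sum branch (gres (@inc R m n) (dpi n lambda)).
Proof.
exists (fun k => HB.pack_for {linear branch k -> gres (@inc R m n) (dpi n lambda)}
  (@branch_emb k) (GRing.isLinear.Build C _ _ _ (@branch_emb k) (@branch_emb_linear k))); split.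
- exact: branch_emb_span.
- exact: branch_emb_inj.
move=> Z N a.
by rewrite [LHS]dpi_act_sum; apply: eq_bigr => k _; exact: branch_emb_act.
Qed.

End Branching.

Theorem theorem5 (R : realType) (n m : nat) (hn : (3 <= n)%N)
    (hm : (1 <= m <= n)%N) :
  let lambda : R := (n%:R - 2) / 2 in
  exists M : nat -> gmod (@h_alg R m n),
    (forall k, is_outer_tensor (dpi m (lambda + k%:R)) (harmonics R (n - m) k) (M k))
    /\ is_direct_sum M (gres (@inc R m n) (dpi n lambda)).
Proof.
by exists (@branch R n m); split=> [k|]; [exact: branch_tensor|exact: branch_sum].
Qed.
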